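(* The theory $V_{NK}$ proves $$\forall G\,\Bigl\{UGraph(G)\rightarrow\bigl[(sg(G)\neq 0\rightarrow AWS_{\tau_A}(G))\land(sg(G)=0\rightarrow BWS_{\tau_B}(G))\bigr]\Bigr\}.$$
   Context: **Two-sorted setting.** $\mathcal{L}_A^2$ is the two-sorted language of Cook and Nguyen: lower case letters are numbers, upper case letters are binary strings (finite sets of numbers), $|X|$ is the length of $X$ (one plus the largest element of $X$, or $0$ if $X=\emptyset$), and $X(i)$, or $i\in X$, says the $i$th bit of $X$ is $1$. $\Sigma^B_0(L)$ is the class of formulas of the language $L$ with only bounded number quantifiers and no string quantifiers. $V^0$ is the theory with the defining axioms for the symbols of $\mathcal{L}_A^2$ and $\Sigma^B_0$ bit-comprehension. Pairs $\langle u,v\rangle$ and finite sequences are coded in the standard way in $V^0$; $*$ is concatenation of sequences (a number is identified with a one-element sequence). **Graphs.** A string $G$ codes a graph by a set of pairs, every node having a loop. $DGraph(G)$ says that every $x\in G$ is of the form $\langle u,v\rangle$ with $u,v<|G|$, and that for all $u<|G|$, if there is $v<|G|$ with $\langle u,v\rangle\in G$ or $\langle v,u\rangle\in G$ then $\langle u,u\rangle\in G$. $UGraph(G)\Leftrightarrow DGraph(G)\land\forall u,v<|G|(\langle u,v\rangle\in G\rightarrow\langle v,u\rangle\in G)$. $Node(G)=V_G=\{u<|G|:\langle u,u\rangle\in G\}$. **Node Kayles.** For $x\in Node(G)$, $G_x$ is the graph with $Node(G_x)=\{y\in Node(G):\langle x,y\rangle\notin G\}$ and $\langle y,z\rangle\in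 G_x\Leftrightarrow y,z\in Node(G_x)\land\langle y,z\rangle\in G$. For a sequence $\bar w$, $G_{\bar w}$ is defined by $G_\emptyset=G$, $G_{\bar w*v}=(G_{\bar w})_v$ if $v\in Node(G_{\bar w})$ and $G_{\bar w*v}=G_{\bar w}$ otherwise. (In Node Kayles, Alice moves first; a move on the current graph $G'$ chooses $x\in Node(G')$ and leaves $G'_x$; the first player unable to move loses.) **The functions $sg,\tau,\tau_A,\tau_B$.** Their defining axioms are: - $sg(G)=0$ if $G=\emptyset$; $sg(G)=\max\{x\in V_G\}+1$ if $\neg UGraph(G)$; and if $UGraph(G)$ and $G\neq\emptyset$, $sg(G)=\min\{k<|V_G|:\forall x\in V_G\; k\neq sg(G_x)\}$ (bounded minimization, with value the bound $|V_G|$ if no such $k$ exists). - $\tau(G)=\min\{v\in V_G: sg(G_v)=0\}$ if such $v$ exists, and $\tau(G)=\max\{v\in V_G\}+1$ otherwise (the maximum of the empty set being taken as $0$). - $\tau_A(\emptyset,G)=\tau(G)$ (a one-element sequence), $\tau_A(\bar b*b,G)=\tau_A(\bar b,G)*\langle b,\tau(G_{\tau_A(\bar b,G)*b})\rangle$. - $\tau_B(\emptyset,G)=\emptyset$, $\tau_B(\bar a*a,G)=\tau_B(\bar a,G)*\langle a,\tau(G_{\tau_B(\bar a,G)*a})\rangle$. **The theory.** $\mathcal{L}_{NK}$ is $\mathcal{L}_A^2$ extended by the function symbols $sg,\tau,\tau_A,\tau_B$. $V_{NK}$ is the $\mathcal{L}_{NK}$-theory with the defining axioms for all symbols of $\mathcal{L}_{NK}$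 and the scheme $\Sigma^B_0(\mathcal{L}_{NK})$-COMP: $\exists X\le a\,\forall y<a\,(X(y)\leftrightarrow\varphi(y))$ for $\varphi\in\Sigma^B_0(\mathcal{L}_{NK})$ without free occurrences of $X$. **Winning-strategy formulas.** Write $\bar b_{<i}=\langle b_0,\ldots,b_{i-1}\rangle$ and $\bar a_{<i}=\langle a_0,\ldots,a_{i-1}\rangle$ (empty if $i=0$). $AWS_{\tau_A}(G)$: for all $l$ and all $\langle b_0,\ldots,b_l\rangle$, if $l=\lfloor |V_G|/2\rfloor$ and $b_i\le|V_G|+1$ for all $i<l$, then there is $l_0\le l$ such that (i) for all $i<l_0$, $b_i\in Node(G_{\tau_A(\bar b_{<i},G)})$ and $\tau(G_{\tau_A(\bar b_{<i},G)*b_i})\in Node(G_{\tau_A(\bar b_{<i},G)*b_i})$; and (ii) $b_{l_0}\notin Node(G_{\tau_A(\bar b_{<l_0},G)})$. $BWS_{\tau_B}(G)$: for all $l$ and all $\langle a_0,\ldots,a_l\rangle$, if $l=\lceil |V_G|/2\rceil$ and $a_i\le|V_G|+1$ for all $i<l$, then there is $l_0\le l$ such that (i) for all $i<l_0$, $a_i\in Node(G_{\tau_B(\bar a_{<i},G)})$ and $\tau(G_{\tau_B(\bar a_{<i},G)*a_i})\in Node(G_{\tau_B(\bar a_{<i},G)*a_i})$; and (ii) $a_{l_0}\notin Node(G_{\tau_B(\bar a_{<l_0},G)})$.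
   Formalization: With only sg, τ, τ_A, τ_B added to the language the claim fails in a nonstandard model; here Node(G), G_x, G_w, w*v, initial segments, entries and length of sequences and the empty string are also function symbols, with their definitions as axioms, and may occur in comprehension. *)

(* Defs.v *)
(* The language L_NK, classical deduction in two-sorted first-order logic, the
   theory V_NK, and the formulas saying that tau_A and tau_B are winning
   strategies in Node Kayles. *)
From Stdlib Require Import List.
Import ListNotations.

(* Number terms and string terms, with de Bruijn indices; number variables and
   string variables are indexed separately.

   [NZero .. Len] are the functions of L_A^2, and [Sg], [Tau], [TauA], [TauB]
   the functions added by L_NK.  The other symbols are the defined functions
   in which the axioms of L_NK are written:

     Empty        the empty string, and the empty sequence
     Node G       the set V_G of nodes of G
     Del G x      the graph G_x
     Pos G W      the graph G_W, for a sequence W of moves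
     Lh W         the length of the sequence W
     Elt W i      the i-th element of W
     Pre W i      the sequence of the first i elements of W
     Snoc W v     the sequence W * v

   They are symbols, and not abbreviations to be eliminated in favour of string
   quantifiers, in order that properties such as sg(G_{tau_A(b_{<i}, G)}) = 0,
   with i a number variable, be Sigma^B_0(L_NK).  Without them no term maps
   numbers to strings, so in a Sigma^B_0 formula the arguments of sg, tau,
   tau_A, tau_B could not depend on bounded variables, and comprehension would
   give nothing beyond V^0.

   As V_G is a string, |V_G| is [Len (Node G)], one plus the largest node. *)
Inductive nterm : Type :=
| NVar (k : nat)
| NZero
| NOne
| NAdd (s t : nterm)
| NMul (s t : nterm)
| Len (X : sterm)
| Sg (G : sterm)
| Tau (G : sterm)
| Lh (W : sterm)
| Elt (W : sterm) (i : nterm)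
with sterm : Type :=
| SVar (k : nat)
| TauA (B G : sterm)
| TauB (A G : sterm)
| Empty
| Node (G : sterm)
| Del (G : sterm) (x : nterm)
| Pos (G W : sterm)
| Pre (W : sterm) (i : nterm)
| Snoc (W : sterm) (v : nterm).

Inductive form : Type :=
| Bot
| EqN (s t : nterm)
| EqS (X Y : sterm)
| Le (s t : nterm)
| Mem (t : nterm) (X : sterm)
| And (p q : form)
| Or (p q : form)
| Imp (p q : form)
| AllNum (p : form)
| ExNum (p : form)
| AllStr (p : form)
| ExStr (p : form).

Declare Scope nterm_scope.
Declare Scope sterm_scope.
Declare Scope form_scope.
Delimit Scope nterm_scope with nt.
Delimit Scope sterm_scope with st.
Delimit Scope form_scope with fm.
Bind Scope nterm_scope with nterm.
Bind Scope sterm_scope with sterm.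
Bind Scope form_scope with form.

Fixpoint nsub (f : nat -> nterm) (g : nat -> sterm) (t : nterm) : nterm :=
  match t with
  | NVar k => f k
  | NZero => NZero
  | NOne => NOne
  | NAdd s t => NAdd (nsub f g s) (nsub f g t)
  | NMul s t => NMul (nsub f g s) (nsub f g t)
  | Len X => Len (ssub f g X)
  | Sg G => Sg (ssub f g G)
  | Tau G => Tau (ssub f g G)
  | Lh W => Lh (ssub f g W)
  | Elt W i => Elt (ssub f g W) (nsub f g i)
  end
with ssub (f : nat -> nterm) (g : nat -> sterm) (X : sterm) : sterm :=
  match X with
  | SVar k => g k
  | TauA B G => TauA (ssub f g B) (ssub f g G)
  | TauB A G => TauB (ssub f g A) (ssub f g G)
  | Empty => Empty
  | Node G => Node (ssub f g G)
  | Del G x => Del (ssub f g G) (nsub f g x)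
  | Pos G W => Pos (ssub f g G) (ssub f g W)
  | Pre W i => Pre (ssub f g W) (nsub f g i)
  | Snoc W v => Snoc (ssub f g W) (nsub f g v)
  end.

Definition shN (k : nat) : nterm := NVar (S k).
Definition shS (k : nat) : sterm := SVar (S k).

Definition scons {A : Type} (a : A) (f : nat -> A) (k : nat) : A :=
  match k with 0 => a | S k' => f k' end.

Fixpoint fsub (f : nat -> nterm) (g : nat -> sterm) (p : form) : form :=
  match p with
  | Bot => Bot
  | EqN s t => EqN (nsub f g s) (nsub f g t)
  | EqS X Y => EqS (ssub f g X) (ssub f g Y)
  | Le s t => Le (nsub f g s) (nsub f g t)
  | Mem t X => Mem (nsub f g t) (ssub f g X)
  | And p q => And (fsub f g p) (fsub f g q)
  | Or p q => Or (fsub f g p) (fsub f g q)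
  | Imp p q => Imp (fsub f g p) (fsub f g q)
  | AllNum p => AllNum (fsub (scons (NVar 0) (fun k => nsub shN SVar (f k)))
                         (fun k => ssub shN SVar (g k)) p)
  | ExNum p => ExNum (fsub (scons (NVar 0) (fun k => nsub shN SVar (f k)))
                       (fun k => ssub shN SVar (g k)) p)
  | AllStr p => AllStr (fsub (fun k => nsub NVar shS (f k))
                         (scons (SVar 0) (fun k => ssub NVar shS (g k))) p)
  | ExStr p => ExStr (fsub (fun k => nsub NVar shS (f k))
                       (scons (SVar 0) (fun k => ssub NVar shS (g k))) p)
  end.

(* [t ↑] and [T ↑] carry a term under one more number binder;
   [T ⇑] carries a string term under one more string binder. *)
Notation "t ↑" := (nsub shN SVar t) (at level 1, format "t ↑") : nterm_scope.
Notation "T ↑" := (ssub shN SVar T) (at level 1, format "T ↑") : sterm_scope.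
Notation "T ⇑" := (ssub NVar shS T) (at level 1, format "T ⇑") : sterm_scope.

Definition liftN (p : form) : form := fsub shN SVar p.
Definition liftS (p : form) : form := fsub NVar shS p.
Definition instN (p : form) (t : nterm) : form := fsub (scons t NVar) SVar p.
Definition instS (p : form) (T : sterm) : form := fsub NVar (scons T SVar) p.

Notation "0" := NZero : nterm_scope.
Notation "1" := NOne : nterm_scope.
Notation "s + t" := (NAdd s t) : nterm_scope.
Notation "s * t" := (NMul s t) : nterm_scope.
Notation "s == t" := (EqN s t) (at level 70, no associativity) : form_scope.
Notation "X === Y" := (EqS X Y) (at level 70, no associativity) : form_scope.
Notation "s <= t" := (Le s t) : form_scope.
Notation "t ∈ X" := (Mem t X) (at level 70, no associativity) : form_scope.
Notation "p ∧ q" := (And p q) (at level 80, right associativity) : form_scope.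
Notation "p ∨ q" := (Or p q) (at level 85, right associativity) : form_scope.
Notation "p → q" := (Imp p q)
  (at level 99, q at level 200, right associativity) : form_scope.

Definition Not (p : form) : form := Imp p Bot.
Definition Iff (p q : form) : form := And (Imp p q) (Imp q p).
Notation "¬ p" := (Not p) (at level 75, right associativity) : form_scope.
Notation "p ↔ q" := (Iff p q) (at level 95, no associativity) : form_scope.

Local Open Scope form_scope.

Definition Lt (s t : nterm) : form := s <= t ∧ ¬ s == t.
Notation "s < t" := (Lt s t) : form_scope.

(* Bounded quantifiers.  The bound is taken outside the binder, so it never
   contains the bound variable. *)
Definition AllLe (t : nterm) (p : form) : form := AllNum (NVar 0 <= t↑ → p).
Definition ExLe (t : nterm) (p : form) : form := ExNum (NVar 0 <= t↑ ∧ p).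
Definition AllLt (t : nterm) (p : form) : form := AllNum (NVar 0 < t↑ → p).
Definition ExLt (t : nterm) (p : form) : form := ExNum (NVar 0 < t↑ ∧ p).
Definition AllIn (T : sterm) (p : form) : form :=
  AllLt (Len T) (NVar 0 ∈ T↑ → p).
Definition ExIn (T : sterm) (p : form) : form :=
  ExLt (Len T) (NVar 0 ∈ T↑ ∧ p).

Inductive Sigma0B : form -> Prop :=
| S0_Bot : Sigma0B Bot
| S0_EqN s t : Sigma0B (s == t)
| S0_EqS X Y : Sigma0B (X === Y)
| S0_Le s t : Sigma0B (s <= t)
| S0_Mem t X : Sigma0B (t ∈ X)
| S0_And p q : Sigma0B p -> Sigma0B q -> Sigma0B (p ∧ q)
| S0_Or p q : Sigma0B p -> Sigma0B q -> Sigma0B (p ∨ q)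
| S0_Imp p q : Sigma0B p -> Sigma0B q -> Sigma0B (p → q)
| S0_AllLe t p : Sigma0B p -> Sigma0B (AllLe t p)
| S0_ExLe t p : Sigma0B p -> Sigma0B (ExLe t p)
| S0_AllLt t p : Sigma0B p -> Sigma0B (AllLt t p)
| S0_ExLt t p : Sigma0B p -> Sigma0B (ExLt t p).

(* Classical natural deduction with equality, from the axioms T and the open
   assumptions in the list.  Free variables of the axioms count as universally
   quantified: the rule [P_ax] may be used under assumptions in which the
   generalization rules shift variables, and T is not shifted. *)
Inductive prv (T : form -> Prop) : list form -> form -> Prop :=
| P_ax c p : T p -> prv T c p
| P_hyp c p : In p c -> prv T c p
| P_raa c p : prv T ((¬ p) :: c) Bot -> prv T c p
| P_andI c p q : prv T c p -> prv T c q -> prv T c (p ∧ q)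
| P_andE1 c p q : prv T c (p ∧ q) -> prv T c p
| P_andE2 c p q : prv T c (p ∧ q) -> prv T c q
| P_orI1 c p q : prv T c p -> prv T c (p ∨ q)
| P_orI2 c p q : prv T c q -> prv T c (p ∨ q)
| P_orE c p q r :
    prv T c (p ∨ q) -> prv T (p :: c) r -> prv T (q :: c) r -> prv T c r
| P_impI c p q : prv T (p :: c) q -> prv T c (p → q)
| P_impE c p q : prv T c (p → q) -> prv T c p -> prv T c q
| P_allNI c p : prv T (map liftN c) p -> prv T c (AllNum p)
| P_allNE c p t : prv T c (AllNum p) -> prv T c (instN p t)
| P_exNI c p t : prv T c (instN p t) -> prv T c (ExNum p)
| P_exNE c p q :
    prv T c (ExNum p) -> prv T (p :: map liftN c) (liftN q) -> prv T c q
| P_allSI c p : prv T (map liftS c) p -> prv T c (AllStr p)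
| P_allSE c p X : prv T c (AllStr p) -> prv T c (instS p X)
| P_exSI c p X : prv T c (instS p X) -> prv T c (ExStr p)
| P_exSE c p q :
    prv T c (ExStr p) -> prv T (p :: map liftS c) (liftS q) -> prv T c q
| P_eqN_refl c t : prv T c (t == t)
| P_eqN_subst c p s t :
    prv T c (s == t) -> prv T c (instN p s) -> prv T c (instN p t)
| P_eqS_refl c X : prv T c (X === X)
| P_eqS_subst c p X Y :
    prv T c (X === Y) -> prv T c (instS p X) -> prv T c (instS p Y).

Definition proves (T : form -> Prop) (p : form) : Prop := prv T [] p.

(* The pairing function of Cook and Nguyen. *)
Definition npair (u v : nterm) : nterm :=
  ((u + v) * ((u + v) + 1) + (v + v))%nt.

Definition DGraph (G : sterm) : form :=
  AllIn G (ExLt (Len G)↑ (ExLt (Len G)↑↑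
    (NVar 2 == npair (NVar 1) (NVar 0))))
  ∧ AllLt (Len G)
      (ExLt (Len G)↑ (npair (NVar 1) (NVar 0) ∈ G↑↑
                      ∨ npair (NVar 0) (NVar 1) ∈ G↑↑)
       → npair (NVar 0) (NVar 0) ∈ G↑).

Definition UGraph (G : sterm) : form :=
  DGraph G
  ∧ AllLt (Len G) (AllLt (Len G)↑
      (npair (NVar 1) (NVar 0) ∈ G↑↑ → npair (NVar 0) (NVar 1) ∈ G↑↑)).

(* A sequence w_0, .., w_(k-1) is coded by the set of the pairs (i, w_i). *)
Definition Seq (W : sterm) : form :=
  AllIn W (ExLt (Lh W)↑ (ExLt (Len W)↑↑ (NVar 2 == npair (NVar 1) (NVar 0))))
  ∧ AllLt (Lh W) (AllLt (Len W)↑ (AllLt (Len W)↑↑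
      (npair (NVar 2) (NVar 1) ∈ W↑↑↑ ∧ npair (NVar 2) (NVar 0) ∈ W↑↑↑
       → NVar 1 == NVar 0))).

(* t is the least k < b with p(k), or b if there is none; [NVar 0] is k in p. *)
Definition IsMin (t b : nterm) (p : form) : form :=
  t <= b ∧ (t < b → instN p t) ∧ AllLt t (¬ p).

(* t is the maximum of X, taken to be 0 if X has no element. *)
Definition IsMax (t : nterm) (X : sterm) : form :=
  (t ∈ X ∧ AllIn X (NVar 0 <= t↑)) ∨ (X === Empty ∧ t == 0).

Inductive LA2_ax : form -> Prop :=
| B1 : let x := NVar 0 in LA2_ax (¬ x + 1 == 0)
| B2 : let x := NVar 0 in let y := NVar 1 in LA2_ax (x + 1 == y + 1 → x == y)
| B3 : let x := NVar 0 in LA2_ax (x + 0 == x)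
| B4 : let x := NVar 0 in let y := NVar 1 in
    LA2_ax (x + (y + 1) == (x + y) + 1)
| B5 : let x := NVar 0 in LA2_ax (x * 0 == 0)
| B6 : let x := NVar 0 in let y := NVar 1 in
    LA2_ax (x * (y + 1) == (x * y) + x)
| B7 : let x := NVar 0 in let y := NVar 1 in
    LA2_ax (x <= y ∧ y <= x → x == y)
| B8 : let x := NVar 0 in let y := NVar 1 in LA2_ax (x <= x + y)
| B9 : let x := NVar 0 in LA2_ax (0 <= x)
| B10 : let x := NVar 0 in let y := NVar 1 in LA2_ax (x <= y ∨ y <= x)
| B11 : let x := NVar 0 in let y := NVar 1 in LA2_ax (x <= y ↔ x < y + 1)
| B12 : let x := NVar 0 in
    LA2_ax (¬ x == 0 → ExLe x (let y := NVar 0 in y + 1 == x↑))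
| L1 : let X := SVar 0 in let y := NVar 0 in LA2_ax (y ∈ X → y < Len X)
| L2 : let X := SVar 0 in let y := NVar 0 in LA2_ax (y + 1 == Len X → y ∈ X)
| SE : let X := SVar 0 in let Y := SVar 1 in
    LA2_ax (Len X == Len Y ∧ AllLt (Len X) (NVar 0 ∈ X ↔ NVar 0 ∈ Y)
            → X === Y).

Inductive Defined_ax : form -> Prop :=
| Empty_def : Defined_ax (Len Empty == 0)
| Node_def :
    let G := SVar 0 in let u := NVar 0 in
    Defined_ax (u ∈ Node G ↔ u < Len G ∧ npair u u ∈ G)
| Del_def :
    let G := SVar 0 in let w := NVar 0 in let x := NVar 1 in
    Defined_ax
      (w ∈ Del G x ↔
       ExLe w (ExLe w↑
         (let y := NVar 1 in let z := NVar 0 in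
          let w := NVar 2 in let x := NVar 3 in
          w == npair y z
          ∧ (y ∈ Node G ∧ ¬ npair x y ∈ G)
          ∧ (z ∈ Node G ∧ ¬ npair x z ∈ G)
          ∧ npair y z ∈ G)))
| Pos_empty : let G := SVar 0 in Defined_ax (Pos G Empty === G)
| Pos_legal :
    let G := SVar 0 in let W := SVar 1 in let v := NVar 0 in
    Defined_ax (Seq W → v ∈ Node (Pos G W)
                → Pos G (Snoc W v) === Del (Pos G W) v)
| Pos_illegal :
    let G := SVar 0 in let W := SVar 1 in let v := NVar 0 in
    Defined_ax (Seq W → ¬ v ∈ Node (Pos G W)
                → Pos G (Snoc W v) === Pos G W)
| Lh_def :
    let W := SVar 0 in
    Defined_ax
      (IsMin (Lh W) (Len W)
         (let i := NVar 0 in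
          AllLt (Len W) (let v := NVar 0 in ¬ npair i↑ v ∈ W)))
| Elt_def :
    let W := SVar 0 in let i := NVar 0 in
    Defined_ax
      (IsMin (Elt W i) (Len W) (let v := NVar 0 in npair i↑ v ∈ W))
| Pre_def :
    let W := SVar 0 in let w := NVar 0 in let i := NVar 1 in
    Defined_ax
      (w ∈ Pre W i ↔
       w ∈ W ∧ ExLt i (ExLe w↑
         (let j := NVar 1 in let v := NVar 0 in
          let w := NVar 2 in w == npair j v)))
| Snoc_def :
    let W := SVar 0 in let w := NVar 0 in let v := NVar 1 in
    Defined_ax (w ∈ Snoc W v ↔ w ∈ W ∨ w == npair (Lh W) v).

Definition Winning (v : nterm) (G : sterm) : form :=
  v ∈ Node G ∧ Sg (Del G v) == 0.

Inductive NK_ax : form -> Prop :=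
| Sg_empty : let G := SVar 0 in NK_ax (G === Empty → Sg G == 0)
| Sg_not_graph :
    let G := SVar 0 in
    NK_ax (¬ UGraph G →
           ExNum (let m := NVar 0 in IsMax m (Node G) ∧ Sg G == m + 1))
| Sg_graph :
    let G := SVar 0 in
    NK_ax (UGraph G → ¬ G === Empty →
           IsMin (Sg G) (Len (Node G))
             (let k := NVar 0 in
              AllIn (Node G) (let x := NVar 0 in ¬ k↑ == Sg (Del G x))))
| Tau_some :
    let G := SVar 0 in
    NK_ax (ExIn (Node G) (Winning (NVar 0) G) →
           Winning (Tau G) G ∧ AllLt (Tau G) (¬ Winning (NVar 0) G))
| Tau_none :
    let G := SVar 0 in
    NK_ax (¬ ExIn (Node G) (Winning (NVar 0) G) →
           ExNum (let m := NVar 0 in IsMax m (Node G) ∧ Tau G == m + 1))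
| TauA_empty :
    let G := SVar 0 in NK_ax (TauA Empty G === Snoc Empty (Tau G))
| TauA_snoc :
    let G := SVar 0 in let B := SVar 1 in let b := NVar 0 in
    NK_ax (Seq B →
           TauA (Snoc B b) G ===
           Snoc (Snoc (TauA B G) b) (Tau (Pos G (Snoc (TauA B G) b))))
| TauB_empty : let G := SVar 0 in NK_ax (TauB Empty G === Empty)
| TauB_snoc :
    let G := SVar 0 in let A := SVar 1 in let a := NVar 0 in
    NK_ax (Seq A →
           TauB (Snoc A a) G ===
           Snoc (Snoc (TauB A G) a) (Tau (Pos G (Snoc (TauB A G) a)))).

(* The instance for p of comprehension.  In p, [NVar 0] is y, [NVar 1] is the
   bound a, and all other variables are parameters; [liftS] makes room for the
   quantified string, which therefore is not free in p. *)
Definition comp_inst (p : form) : form :=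
  let a := NVar 0 in let X := SVar 0 in
  ExStr (Len X <= a ∧ AllLt a (NVar 0 ∈ X ↔ liftS p)).

Inductive VNK : form -> Prop :=
| VNK_LA2 p : LA2_ax p -> VNK p
| VNK_defined p : Defined_ax p -> VNK p
| VNK_NK p : NK_ax p -> VNK p
| VNK_comp p : Sigma0B p -> VNK (comp_inst p).

(* The two winning-strategy formulas differ only in l and in the strategy, here
   the string term [strat C G] for a sequence C of moves of the opponent.  [half]
   says how l depends on n = |V_G|. *)
Definition WS (strat : sterm -> sterm -> sterm)
    (half : nterm -> nterm -> form) (G : sterm) : form :=
  AllNum (AllStr (
    let G := (G↑⇑)%st in let C := SVar 0 in
    let n := Len (Node G) in
    let l := NVar 0 in
    Seq C ∧ Lh C == l + 1 →
    half l n ∧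
    (let G := (G↑)%st in let i := NVar 0 in
     AllLt l (Elt C i <= Len (Node G) + 1)) →
    ExLe l
      (let G := (G↑)%st in let l0 := NVar 0 in
       let at_ G i := strat (Pre C i) G in
       AllLt l0
         (let G := (G↑)%st in let i := NVar 0 in
          let W := Snoc (at_ G i) (Elt C i) in
          Elt C i ∈ Node (Pos G (at_ G i))
          ∧ Tau (Pos G W) ∈ Node (Pos G W))
       ∧ ¬ Elt C l0 ∈ Node (Pos G (at_ G l0))))).

Definition is_floor_half (l n : nterm) : form := l + l == n ∨ (l + l) + 1 == n.
Definition is_ceil_half (l n : nterm) : form := l + l == n ∨ l + l == n + 1.

Definition AWS (G : sterm) : form := WS TauA is_floor_half G.
Definition BWS (G : sterm) : form := WS TauB is_ceil_half G.

(* Main.v *)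
From Stdlib Require Import List Lia PeanoNat Cantor Classical ClassicalEpsilon
  FunctionalExtensionality PropExtensionality ProofIrrelevance Ring.
Require Import Defs.
Import ListNotations.

(** A formula that holds in every model of a theory is derivable from it
    ([completeness], by a Henkin construction), so it suffices to argue in an
    arbitrary, possibly nonstandard, model of the theory.  There every predicate
    defined by a Sigma^B_0 formula with parameters admits comprehension, hence
    [induction] and the [least] number principle, and these are the only forms
    of induction available.

    The game part is the usual theory of impartial games.  If sg is 0, every
    move leads to a position with sg nonzero ([sg_zero]); if sg is nonzero, tau
    is a move to a position with sg equal to 0 ([sg_nonzero]).  So, as long as
    the opponent has played legally, the position in which the opponent is to
    move is a graph with sg equal to 0, and the answer given by tau is legal
    ([losing_step], [losing_invariant]).  The number l_0 of the theorem is the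
    least index of an illegal move of the opponent.

    What remains is that an illegal move occurs among the first l + 1.
    Otherwise l + 1 moves and as many answers remove 2(l + 1) > n nodes, where
    all nodes are below n = |V_G| ([too_many_moves]).  This is a pigeonhole
    argument, which Sigma^B_0 comprehension over L_A^2 alone cannot carry out,
    so sets have to be counted by means of the game functions.  The source of
    strength is the function W |-> G_W.  Playing the sequence 0, 1, 2, ... on a
    graph accepts a vertex exactly when no accepted smaller vertex is adjacent
    to it; thus every ordered graph has a kernel that is a string of the model
    ([kernel_exists]).  Evaluating a kernel is evaluating a circuit of NOR gates,
    and counting needs only a simple one: the vertex (k, a, b) is to be accepted
    if the k-th set has, below a + b, exactly b elements and a non-elements.  It
    is joined to all vertices of the next level except the one that the lattice
    path of the set moves on to ([lattice_kernel]); if exactly one vertex of a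
    level is accepted, then exactly that successor is accepted on the next level
    ([counts_rows_exists]).  The counts so obtained decrease along a
    strictly decreasing chain of sets, and so the chain of the node sets of the
    successive positions has at most n proper steps ([strict_chain_length]). *)

(** * Substitution *)

Scheme nterm_mut := Induction for nterm Sort Prop
  with sterm_mut := Induction for sterm Sort Prop.
Combined Scheme term_mut from nterm_mut, sterm_mut.

Definition upN (f : nat -> nterm) : nat -> nterm :=
  scons (NVar 0) (fun k => nsub shN SVar (f k)).
Definition upS (g : nat -> sterm) : nat -> sterm :=
  scons (SVar 0) (fun k => ssub NVar shS (g k)).

Lemma sub_comp_term f g f' g' :
  (forall t, nsub f g (nsub f' g' t) =
     nsub (fun k => nsub f g (f' k)) (fun k => ssub f g (g' k)) t) /\
  (forall X, ssub f g (ssub f' g' X) =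
     ssub (fun k => nsub f g (f' k)) (fun k => ssub f g (g' k)) X).
Proof. apply term_mut; intros; cbn; congruence. Qed.

Lemma nsub_comp f g f' g' t :
  nsub f g (nsub f' g' t) =
  nsub (fun k => nsub f g (f' k)) (fun k => ssub f g (g' k)) t.
Proof. apply sub_comp_term. Qed.

Lemma ssub_comp f g f' g' X :
  ssub f g (ssub f' g' X) =
  ssub (fun k => nsub f g (f' k)) (fun k => ssub f g (g' k)) X.
Proof. apply sub_comp_term. Qed.

Lemma sub_id_term :
  (forall t, nsub NVar SVar t = t) /\ (forall X, ssub NVar SVar X = X).
Proof. apply term_mut; intros; cbn; congruence. Qed.

Lemma nsub_id t : nsub NVar SVar t = t.
Proof. apply sub_id_term. Qed.

Lemma ssub_id X : ssub NVar SVar X = X.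
Proof. apply sub_id_term. Qed.

Lemma fsub_id p : fsub NVar SVar p = p.
Proof.
  induction p; cbn; rewrite ?nsub_id, ?ssub_id; try congruence;
    f_equal; rewrite <- IHp at 2; f_equal;
    extensionality k; try destruct k; reflexivity.
Qed.

Lemma fsub_comp p : forall f g f' g',
  fsub f g (fsub f' g' p) =
  fsub (fun k => nsub f g (f' k)) (fun k => ssub f g (g' k)) p.
Proof.
  induction p; intros; cbn; rewrite ?nsub_comp, ?ssub_comp, ?IHp1, ?IHp2, ?IHp;
    try reflexivity; f_equal; f_equal; extensionality k;
    try destruct k; cbn; rewrite ?nsub_comp, ?ssub_comp; reflexivity.
Qed.

Lemma nsub_scons_lift t s : nsub (scons s NVar) SVar (nsub shN SVar t) = t.
Proof. rewrite nsub_comp. apply nsub_id. Qed.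
Lemma ssub_scons_lift t s : ssub (scons s NVar) SVar (ssub shN SVar t) = t.
Proof. rewrite ssub_comp. apply ssub_id. Qed.
Lemma nsub_scons_liftS t s : nsub NVar (scons s SVar) (nsub NVar shS t) = t.
Proof. rewrite nsub_comp. apply nsub_id. Qed.
Lemma ssub_scons_liftS t s : ssub NVar (scons s SVar) (ssub NVar shS t) = t.
Proof. rewrite ssub_comp. apply ssub_id. Qed.

Lemma instN_up f g p t :
  instN (fsub (upN f) (fun k => ssub shN SVar (g k)) p) t = fsub (scons t f) g p.
Proof.
  unfold instN. rewrite fsub_comp. f_equal; extensionality k.
  - destruct k; [reflexivity|]. apply nsub_scons_lift.
  - apply ssub_scons_lift.
Qed.

Lemma instS_up f g p X :
  instS (fsub (fun k => nsub NVar shS (f k)) (upS g) p) X = fsub f (scons X g) p.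
Proof.
  unfold instS. rewrite fsub_comp. f_equal; extensionality k.
  - apply nsub_scons_liftS.
  - destruct k; [reflexivity|]. apply ssub_scons_liftS.
Qed.

(** All free variables are below k, expressed by the insensitivity of
    substitution to the other variables. *)
Definition bounded (k : nat) (p : form) : Prop :=
  forall f f' g g', (forall i, i < k -> f i = f' i) ->
  (forall i, i < k -> g i = g' i) -> fsub f g p = fsub f' g' p.
Definition nbounded (k : nat) (t : nterm) : Prop :=
  forall f f' g g', (forall i, i < k -> f i = f' i) ->
  (forall i, i < k -> g i = g' i) -> nsub f g t = nsub f' g' t.
Definition sbounded (k : nat) (X : sterm) : Prop :=
  forall f f' g g', (forall i, i < k -> f i = f' i) ->
  (forall i, i < k -> g i = g' i) -> ssub f g X = ssub f' g' X.

Lemma nbounded_le k k' t : k <= k' -> nbounded k t -> nbounded k' t.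
Proof. intros L B f f' g g' F G. apply B; intros; [apply F|apply G]; lia. Qed.
Lemma bounded_le k k' p : k <= k' -> bounded k p -> bounded k' p.
Proof. intros L B f f' g g' F G. apply B; intros; [apply F|apply G]; lia. Qed.

Lemma term_bounded :
  (forall t, exists k, nbounded k t) /\ (forall X, exists k, sbounded k X).
Proof.
  apply term_mut; intros;
  repeat match goal with H : exists k, _ |- _ =>
    let j := fresh "j" in destruct H as [j ?] end;
  match goal with
  | i : nat, j : nat |- _ => exists (i + j)
  | j : nat |- _ => exists (S j)
  | _ => exists 0
  end;
  intros f f' g g' E E'; cbn; auto with arith; f_equal;
  match goal with B : _ |- _ => apply B end;
  intros; (apply E || apply E'); lia.
Qed.

Lemma form_bounded p : exists k, bounded k p.
Proof.
  induction p;
  repeat match goal with H : exists k, _ |- _ =>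
    let j := fresh "j" in destruct H as [j ?] end;
  repeat match goal with t : nterm |- _ =>
    let j := fresh "j" in destruct (proj1 term_bounded t) as [j ?]; revert t H
  | X : sterm |- _ =>
    let j := fresh "j" in destruct (proj2 term_bounded X) as [j ?]; revert X H
  end; intros;
  match goal with
  | i : nat, j : nat |- _ => exists (i + j)
  | j : nat |- _ => exists j
  | _ => exists 0
  end;
  intros f f' g g' E E'; cbn; auto; f_equal;
  match goal with B : _ |- _ => apply B end;
  intros i L; try destruct i; cbn; rewrite ?E, ?E' by lia; reflexivity.
Qed.

Lemma forms_bounded (c : list form) :
  exists k, forall p, In p c -> bounded k p.
Proof.
  induction c as [|p c [k K]]; [exists 0; intros _ []|].
  destruct (form_bounded p) as [j J]. exists (k + j).
  intros q [<-|I]; [apply (bounded_le j)|apply (bounded_le k)]; auto; lia.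
Qed.

Lemma nterms_bounded (f : nat -> nterm) k :
  exists K, forall i, i < k -> nbounded K (f i).
Proof.
  induction k as [|k [K HK]]; [exists 0; lia|].
  destruct (proj1 term_bounded (f k)) as [j J]. exists (K + j). intros i L.
  destruct (Nat.eq_dec i k) as [->|N];
    [apply (nbounded_le j)|apply (nbounded_le K); [|apply HK]]; auto; lia.
Qed.

(** * Derivations *)

Section Derivations.
Variable T : form -> Prop.

Lemma prv_weaken c p : prv T c p -> forall c', incl c c' -> prv T c' p.
Proof.
  assert (I1 : forall (a : form) c c', incl c c' -> incl (a :: c) (a :: c'))
    by (intros a l l' H x [->|Hx]; [now left|right; auto]).
  assert (I2 : forall (h : form -> form) c c', incl c c' -> incl (map h c) (map h c'))
    by (intros h l l' H x Hx; apply in_map_iff in Hx as (y & <- & Hy);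
        apply in_map; auto).
  induction 1; intros c' Hc;
    [apply P_ax|apply P_hyp|apply P_raa|apply P_andI|eapply P_andE1
    |eapply P_andE2|apply P_orI1|apply P_orI2|eapply P_orE|apply P_impI
    |eapply P_impE|apply P_allNI|apply P_allNE|eapply P_exNI|eapply P_exNE
    |apply P_allSI|apply P_allSE|eapply P_exSI|eapply P_exSE|apply P_eqN_refl
    |eapply P_eqN_subst|apply P_eqS_refl|eapply P_eqS_subst]; eauto.
Qed.

Fixpoint imps (c : list form) (p : form) : form :=
  match c with [] => p | a :: c => imps c (a → p)%fm end.

(** Moving the context into the formula reduces closure of derivations under
    substitution to derivations from the empty context, where the rules of
    generalization shift nothing. *)
Lemma prv_imps c : forall p, prv T c p <-> prv T [] (imps c p).
Proof.
  enough (H : forall c d p, prv T (c ++ d) p <-> prv T d (imps c p)).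
  { intros p. rewrite <- (app_nil_r c) at 1. apply H. }
  clear c; induction c as [|a c IH]; intros d p; cbn; [reflexivity|].
  rewrite <- IH. split; intros H.
  - apply P_impI, H.
  - apply P_impE with a; [|apply P_hyp; now left].
    apply (prv_weaken _ _ H). intros x Hx; now right.
Qed.

Lemma fsub_imps f g c : forall p,
  fsub f g (imps c p) = imps (map (fsub f g) c) (fsub f g p).
Proof. induction c as [|a c IH]; intros p; cbn; [|rewrite IH]; reflexivity. Qed.

Fixpoint allsN (k : nat) (p : form) : form :=
  match k with 0 => p | S k => AllNum (allsN k p) end.
Fixpoint allsS (k : nat) (p : form) : form :=
  match k with 0 => p | S k => AllStr (allsS k p) end.
Fixpoint upsN (k : nat) (f : nat -> nterm) : nat -> nterm :=
  match k with 0 => f | S k => upsN k (upN f) end.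
Fixpoint upsS (k : nat) (g : nat -> sterm) : nat -> sterm :=
  match k with 0 => g | S k => upsS k (upS g) end.

Lemma fsub_allsN k : forall f p,
  fsub f SVar (allsN k p) = allsN k (fsub (upsN k f) SVar p).
Proof. induction k; intros; cbn; [|rewrite <- IHk]; reflexivity. Qed.
Lemma fsub_allsS k : forall g p,
  fsub NVar g (allsS k p) = allsS k (fsub NVar (upsS k g) p).
Proof. induction k; intros; cbn; [|rewrite <- IHk]; reflexivity. Qed.

Lemma upsN_comp k : forall f f',
  (fun i => nsub (upsN k f) SVar (upsN k f' i)) =
  upsN k (fun i => nsub f SVar (f' i)).
Proof.
  induction k; intros; cbn; [reflexivity|]. rewrite IHk. f_equal.
  extensionality i; destruct i; cbn; [reflexivity|].
  now rewrite !nsub_comp.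
Qed.
Lemma upsS_comp k : forall g g',
  (fun i => ssub NVar (upsS k g) (upsS k g' i)) =
  upsS k (fun i => ssub NVar g (g' i)).
Proof.
  induction k; intros; cbn; [reflexivity|]. rewrite IHk. f_equal.
  extensionality i; destruct i; cbn; [reflexivity|].
  now rewrite !ssub_comp.
Qed.

Lemma upN_low j f : (forall i, i < j -> f i = NVar i) ->
  forall i, i < S j -> upN f i = NVar i.
Proof. intros H [|i] L; cbn; [|rewrite H by lia]; reflexivity. Qed.
Lemma upS_low j g : (forall i, i < j -> g i = SVar i) ->
  forall i, i < S j -> upS g i = SVar i.
Proof. intros H [|i] L; cbn; [|rewrite H by lia]; reflexivity. Qed.

Lemma upsN_low k : forall j f, (forall i, i < j -> f i = NVar i) ->
  forall i, i < k + j -> upsN k f i = NVar i.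
Proof.
  induction k; cbn; intros j f H i L; [now apply H|].
  apply (IHk (S j)); [now apply upN_low|lia].
Qed.
Lemma upsS_low k : forall j g, (forall i, i < j -> g i = SVar i) ->
  forall i, i < k + j -> upsS k g i = SVar i.
Proof.
  induction k; cbn; intros j f H i L; [now apply H|].
  apply (IHk (S j)); [now apply upS_low|lia].
Qed.

(** All k variables of p are generalized and then instantiated one by one, from
    the outermost quantifier; those not yet instantiated stay bound, so that the
    variables of the terms f j are not captured.  After d instantiations k - d
    quantifiers are left. *)
Lemma prv_subN p f : prv T [] p -> prv T [] (fsub f SVar p).
Proof.
  intros H. destruct (form_bounded p) as [k K].
  assert (D : forall d, d <= k -> prv T [] (allsN (k - d)
            (fsub (upsN (k - d) (fun j => f (k - d + j))) SVar p))).
  { induction d as [|d IH]; intros L.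
    - rewrite Nat.sub_0_r, (K _ NVar _ SVar), fsub_id.
      + clear K L; induction k; cbn; [exact H|]. now apply P_allNI.
      + intros i Hi. apply (upsN_low k 0); lia.
      + reflexivity.
    - specialize (IH ltac:(lia)).
      replace (k - d) with (S (k - S d)) in IH by lia. cbn [allsN] in IH.
      apply P_allNE with (t := f (k - S d)) in IH.
      unfold instN in IH. rewrite fsub_allsN, fsub_comp in IH.
      rewrite <- (nsub_id (f (k - S d))) in IH.
      cbn [upsN ssub] in IH. rewrite upsN_comp in IH.
      match type of IH with context[upsN _ ?h] =>
        replace h with (fun j => f (k - S d + j)) in IH end; [exact IH|].
      extensionality j; destruct j; cbn.
      + now rewrite Nat.add_0_r, nsub_id.
      + rewrite nsub_scons_lift. f_equal; lia. }
  specialize (D k ltac:(lia)). now rewrite Nat.sub_diag in D.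
Qed.

Lemma prv_subS p g : prv T [] p -> prv T [] (fsub NVar g p).
Proof.
  intros H. destruct (form_bounded p) as [k K].
  assert (D : forall d, d <= k -> prv T [] (allsS (k - d)
            (fsub NVar (upsS (k - d) (fun j => g (k - d + j))) p))).
  { induction d as [|d IH]; intros L.
    - rewrite Nat.sub_0_r, (K _ NVar _ SVar), fsub_id.
      + clear K L; induction k; cbn; [exact H|]. now apply P_allSI.
      + reflexivity.
      + intros i Hi. apply (upsS_low k 0); lia.
    - specialize (IH ltac:(lia)).
      replace (k - d) with (S (k - S d)) in IH by lia. cbn [allsS] in IH.
      apply P_allSE with (X := g (k - S d)) in IH.
      unfold instS in IH. rewrite fsub_allsS, fsub_comp in IH.
      cbn [upsS nsub] in IH. rewrite upsS_comp in IH.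
      match type of IH with context[upsS _ ?h] =>
        replace h with (fun j => g (k - S d + j)) in IH end; [exact IH|].
      extensionality j; destruct j; cbn.
      + now rewrite Nat.add_0_r.
      + rewrite ssub_scons_liftS. f_equal; lia. }
  specialize (D k ltac:(lia)). now rewrite Nat.sub_diag in D.
Qed.

(** Substituting first in one sort and then in the other would also substitute
    in the string variables of the terms f i.  So the string variables of p are
    first moved out of the way, beyond the bound K of those terms. *)
Lemma prv_sub p f g : prv T [] p -> prv T [] (fsub f g p).
Proof.
  intros H. destruct (form_bounded p) as [k Hk].
  destruct (nterms_bounded f k) as [K HK].
  set (g' := fun j => if j <? K then SVar j else g (j - K)).
  apply (prv_subS _ (fun j => SVar (K + j))), (prv_subN _ f), (prv_subS _ g') in H.
  rewrite !fsub_comp in H. cbn in H.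
  rewrite (Hk f (fun k => nsub NVar g' (f k)) g (fun k => g' (K + k))); [exact H| |].
  - intros i Hi. rewrite <- (nsub_id (f i)) at 1. apply HK; auto.
    intros j Hj. unfold g'. now apply Nat.ltb_lt in Hj as ->.
  - intros i _. unfold g'. destruct (Nat.ltb_spec (K + i) K); [lia|].
    f_equal; lia.
Qed.

(** A variable that is not free in the context may be renamed to the one that the
    elimination rule for the existential quantifier binds. *)
Lemma prv_freshN c q k :
  (forall p, In p c -> bounded k p) -> bounded k q ->
  prv T (instN q (NVar k) :: c) Bot -> prv T (q :: map liftN c) Bot.
Proof.
  intros Hc Hq H. apply prv_imps in H.
  set (f := fun j => if j =? k then NVar 0 else NVar (S j)).
  apply (prv_subN _ f) in H.
  rewrite fsub_imps in H. apply prv_imps in H. cbn in H.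
  assert (E : fsub f SVar (instN q (NVar k)) = q).
  { unfold instN. rewrite fsub_comp. rewrite <- fsub_id. apply Hq.
    - intros [|i] L; cbn; unfold f; [rewrite Nat.eqb_refl; reflexivity|].
      destruct (Nat.eqb_spec i k); [lia|reflexivity].
    - reflexivity. }
  rewrite E in H. replace (map liftN c) with (map (fsub f SVar) c); [exact H|].
  apply map_ext_in. intros p Hp. apply Hc; [assumption| |reflexivity].
  intros i L. unfold f. destruct (Nat.eqb_spec i k); [lia|reflexivity].
Qed.

Lemma prv_freshS c q k :
  (forall p, In p c -> bounded k p) -> bounded k q ->
  prv T (instS q (SVar k) :: c) Bot -> prv T (q :: map liftS c) Bot.
Proof.
  intros Hc Hq H. apply prv_imps in H.
  set (f := fun j => if j =? k then SVar 0 else SVar (S j)).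
  apply (prv_subS _ f) in H.
  rewrite fsub_imps in H. apply prv_imps in H. cbn in H.
  assert (E : fsub NVar f (instS q (SVar k)) = q).
  { unfold instS. rewrite fsub_comp. rewrite <- fsub_id. apply Hq.
    - reflexivity.
    - intros [|i] L; cbn; unfold f; [rewrite Nat.eqb_refl; reflexivity|].
      destruct (Nat.eqb_spec i k); [lia|reflexivity]. }
  rewrite E in H. replace (map liftS c) with (map (fsub NVar f) c); [exact H|].
  apply map_ext_in. intros p Hp. apply Hc; [assumption|reflexivity|].
  intros i L. unfold f. destruct (Nat.eqb_spec i k); [lia|reflexivity].
Qed.

End Derivations.

(** * Structures and satisfaction *)

Record structure := {
  num : Type; str : Type;
  zeroM : num; oneM : num; addM : num -> num -> num; mulM : num -> num -> num;
  lenM : str -> num; sgM : str -> num; tauM : str -> num; lhM : str -> num;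
  eltM : str -> num -> num;
  tauAM : str -> str -> str; tauBM : str -> str -> str;
  emptyM : str; nodeM : str -> str; delM : str -> num -> str;
  posM : str -> str -> str; preM : str -> num -> str; snocM : str -> num -> str;
  leM : num -> num -> Prop; memM : num -> str -> Prop }.

Fixpoint evN (M : structure) (r : nat -> num M) (s : nat -> str M)
    (t : nterm) : num M :=
  match t with
  | NVar k => r k
  | NZero => zeroM M
  | NOne => oneM M
  | NAdd t u => addM M (evN M r s t) (evN M r s u)
  | NMul t u => mulM M (evN M r s t) (evN M r s u)
  | Len X => lenM M (evS M r s X)
  | Sg G => sgM M (evS M r s G)
  | Tau G => tauM M (evS M r s G)
  | Lh W => lhM M (evS M r s W)
  | Elt W i => eltM M (evS M r s W) (evN M r s i)
  end
with evS (M : structure) (r : nat -> num M) (s : nat -> str M)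
    (X : sterm) : str M :=
  match X with
  | SVar k => s k
  | TauA B G => tauAM M (evS M r s B) (evS M r s G)
  | TauB A G => tauBM M (evS M r s A) (evS M r s G)
  | Empty => emptyM M
  | Node G => nodeM M (evS M r s G)
  | Del G x => delM M (evS M r s G) (evN M r s x)
  | Pos G W => posM M (evS M r s G) (evS M r s W)
  | Pre W i => preM M (evS M r s W) (evN M r s i)
  | Snoc W v => snocM M (evS M r s W) (evN M r s v)
  end.

Fixpoint sat (M : structure) (r : nat -> num M) (s : nat -> str M)
    (p : form) : Prop :=
  match p with
  | Bot => False
  | EqN t u => evN M r s t = evN M r s u
  | EqS X Y => evS M r s X = evS M r s Y
  | Le t u => leM M (evN M r s t) (evN M r s u)
  | Mem t X => memM M (evN M r s t) (evS M r s X)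
  | And p q => sat M r s p /\ sat M r s q
  | Or p q => sat M r s p \/ sat M r s q
  | Imp p q => sat M r s p -> sat M r s q
  | AllNum p => forall x, sat M (scons x r) s p
  | ExNum p => exists x, sat M (scons x r) s p
  | AllStr p => forall X, sat M r (scons X s) p
  | ExStr p => exists X, sat M r (scons X s) p
  end.

Definition models (M : structure) (T : form -> Prop) : Prop :=
  forall p, T p -> forall r s, sat M r s p.

Lemma ev_sub M r s f g :
  (forall t, evN M r s (nsub f g t) =
     evN M (fun k => evN M r s (f k)) (fun k => evS M r s (g k)) t) /\
  (forall X, evS M r s (ssub f g X) =
     evS M (fun k => evN M r s (f k)) (fun k => evS M r s (g k)) X).
Proof. apply term_mut; intros; cbn; congruence. Qed.

Lemma sat_sub M p : forall r s f g,
  sat M r s (fsub f g p) <->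
  sat M (fun k => evN M r s (f k)) (fun k => evS M r s (g k)) p.
Proof.
  assert (EN : forall x r s f, (fun k => evN M (scons x r) s (upN f k)) =
                scons x (fun k => evN M r s (f k))).
  { intros. extensionality k. destruct k; cbn; [reflexivity|]. apply ev_sub. }
  assert (ES : forall X r s g, (fun k => evS M r (scons X s) (upS g k)) =
                scons X (fun k => evS M r s (g k))).
  { intros. extensionality k. destruct k; cbn; [reflexivity|]. apply ev_sub. }
  assert (EN' : forall X r s (f : nat -> nterm), (fun k => evN M r (scons X s) (nsub NVar shS (f k)))
                = (fun k => evN M r s (f k))).
  { intros. extensionality k. apply ev_sub. }
  assert (ES' : forall x r s (g : nat -> sterm), (fun k => evS M (scons x r) s (ssub shN SVar (g k)))
                = (fun k => evS M r s (g k))).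
  { intros. extensionality k. apply ev_sub. }
  induction p; intros; cbn;
    rewrite ?(proj1 (ev_sub _ _ _ _ _)), ?(proj2 (ev_sub _ _ _ _ _)),
      ?IHp1, ?IHp2; try reflexivity;
    [apply Morphisms_Prop.all_iff_morphism | apply Morphisms_Prop.ex_iff_morphism
    |apply Morphisms_Prop.all_iff_morphism | apply Morphisms_Prop.ex_iff_morphism];
    intros x; rewrite IHp; fold (upN f); fold (upS g);
    rewrite ?EN, ?ES, ?EN', ?ES'; reflexivity.
Qed.

(** * Countability of the language *)

Fixpoint codeN (t : nterm) : nat :=
  match t with
  | NVar k => to_nat (0, k)
  | NZero => to_nat (1, 0)
  | NOne => to_nat (2, 0)
  | NAdd t u => to_nat (3, to_nat (codeN t, codeN u))
  | NMul t u => to_nat (4, to_nat (codeN t, codeN u))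
  | Len X => to_nat (5, codeS X)
  | Sg X => to_nat (6, codeS X)
  | Tau X => to_nat (7, codeS X)
  | Lh X => to_nat (8, codeS X)
  | Elt X t => to_nat (9, to_nat (codeS X, codeN t))
  end
with codeS (X : sterm) : nat :=
  match X with
  | SVar k => to_nat (0, k)
  | TauA X Y => to_nat (1, to_nat (codeS X, codeS Y))
  | TauB X Y => to_nat (2, to_nat (codeS X, codeS Y))
  | Empty => to_nat (3, 0)
  | Node X => to_nat (4, codeS X)
  | Del X t => to_nat (5, to_nat (codeS X, codeN t))
  | Pos X Y => to_nat (6, to_nat (codeS X, codeS Y))
  | Pre X t => to_nat (7, to_nat (codeS X, codeN t))
  | Snoc X t => to_nat (8, to_nat (codeS X, codeN t))
  end.

Fixpoint codeF (p : form) : nat :=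
  match p with
  | Bot => to_nat (0, 0)
  | EqN t u => to_nat (1, to_nat (codeN t, codeN u))
  | EqS X Y => to_nat (2, to_nat (codeS X, codeS Y))
  | Le t u => to_nat (3, to_nat (codeN t, codeN u))
  | Mem t X => to_nat (4, to_nat (codeN t, codeS X))
  | And p q => to_nat (5, to_nat (codeF p, codeF q))
  | Or p q => to_nat (6, to_nat (codeF p, codeF q))
  | Imp p q => to_nat (7, to_nat (codeF p, codeF q))
  | AllNum p => to_nat (8, codeF p)
  | ExNum p => to_nat (9, codeF p)
  | AllStr p => to_nat (10, codeF p)
  | ExStr p => to_nat (11, codeF p)
  end.

Lemma to_nat_pair_inj a b c d : to_nat (a, b) = to_nat (c, d) -> a = c /\ b = d.
Proof. intros H. apply to_nat_inj in H. now injection H. Qed.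

Ltac code_inj :=
  repeat match goal with
  | H : to_nat (_, _) = to_nat (_, _) |- _ =>
      apply to_nat_pair_inj in H as [? ?]; try discriminate
  end; subst; try reflexivity; f_equal; auto.

Lemma code_inj_term :
  (forall t u, codeN t = codeN u -> t = u) /\
  (forall X Y, codeS X = codeS Y -> X = Y).
Proof.
  apply term_mut; intros;
    match goal with
    | H : codeN _ = codeN ?u |- _ => destruct u
    | H : codeS _ = codeS ?u |- _ => destruct u
    end;
    cbn [codeN codeS] in *; code_inj.
Qed.

Lemma codeF_inj p : forall q, codeF p = codeF q -> p = q.
Proof.
  induction p; intros q H; destruct q; cbn [codeF] in *; code_inj;
    now apply code_inj_term.
Qed.

Lemma form_enumeration : exists e : nat -> form, forall p, exists n, e n = p.
Proof.
  exists (fun n => epsilon (inhabits Bot) (fun p => codeF p = n)).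
  intros p. exists (codeF p). apply codeF_inj.
  exact (epsilon_spec (inhabits Bot) (fun q => codeF q = codeF p)
           (ex_intro _ p eq_refl)).
Qed.

(** * Complete Henkin theories *)

(** The theories whose terms form a model. *)
Record henkin (T Th : form -> Prop) : Prop := {
  h_ded : forall c p, (forall a, In a c -> Th a) -> prv T c p -> Th p;
  h_con : ~ Th Bot;
  h_dec : forall p, Th p \/ Th (Not p);
  h_exN : forall p, Th (ExNum p) -> exists t, Th (instN p t);
  h_exS : forall p, Th (ExStr p) -> exists X, Th (instS p X) }.

Section Lindenbaum.
Variable T : form -> Prop.

Definition consistent (c : list form) : Prop := ~ prv T c Bot.

Definition settles (c : list form) (p : form) : Prop :=
  In (Not p) c \/
  In p c /\ (forall q, p = ExNum q -> exists t, In (instN q t) c)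
         /\ (forall q, p = ExStr q -> exists X, In (instS q X) c).

(** Only an existential formula that is consistent with c needs more than itself
    or its negation to be added: its witness is a variable beyond all variables
    of the context, which is harmless by [prv_freshN] and [prv_freshS]. *)
Lemma settle c p : consistent c ->
  exists c', consistent c' /\ incl c c' /\ settles c' p.
Proof.
  intros Hc. destruct (classic (prv T (p :: c) Bot)) as [H|H].
  - exists (Not p :: c). split; [|split; [now intros x; right|left; now left]].
    intros H'. apply Hc. eapply P_impE; [apply P_impI, H|apply P_raa, H'].
  - assert (R : (forall q, p <> ExNum q) -> (forall q, p <> ExStr q) ->
      exists c', consistent c' /\ incl c c' /\ settles c' p).
    { intros N1 N2. exists (p :: c). split; [exact H|].
      split; [now intros x; right|]. right. split; [now left|].
      split; intros q E; [now apply N1 in E|now apply N2 in E]. }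
    destruct p; try (apply R; discriminate); clear R.
    + destruct (forms_bounded (p :: ExNum p :: c)) as [k K].
      exists (instN p (NVar k) :: ExNum p :: c). split; [|split].
      * intros D. apply prv_freshN in D; [|intros; apply K; now right|apply K; now left].
        apply H. eapply P_exNE; [apply P_hyp; now left|exact D].
      * intros x; right; now right.
      * right. split; [right; now left|]. split; [|discriminate].
        intros q [= <-]. exists (NVar k). now left.
    + destruct (forms_bounded (p :: ExStr p :: c)) as [k K].
      exists (instS p (SVar k) :: ExStr p :: c). split; [|split].
      * intros D. apply prv_freshS in D; [|intros; apply K; now right|apply K; now left].
        apply H. eapply P_exSE; [apply P_hyp; now left|exact D].
      * intros x; right; now right.
      * right. split; [right; now left|]. split; [discriminate|].
        intros q [= <-]. exists (SVar k). now left.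
Qed.

Lemma lindenbaum c : consistent c ->
  exists Th, henkin T Th /\ forall p, In p c -> Th p.
Proof.
  intros Hc. destruct form_enumeration as [e He].
  set (step := fun (c : {c | consistent c}) p =>
    let s := constructive_indefinite_description _ (settle (proj1_sig c) p (proj2_sig c))
    in exist consistent (proj1_sig s) (proj1 (proj2_sig s))).
  set (G := fix G n := match n with
    0 => exist consistent c Hc | S n => step (G n) (e n) end).
  assert (HS : forall n, incl (proj1_sig (G n)) (proj1_sig (G (S n))) /\
                         settles (proj1_sig (G (S n))) (e n)).
  { intros n. cbn. destruct constructive_indefinite_description as (c' & A1 & A2 & A3).
    now split. }
  assert (Hmono : forall n m, n <= m -> incl (proj1_sig (G n)) (proj1_sig (G m))).
  { intros n m L. induction L; [now intros x|].
    intros x Hx. now apply HS, IHL. }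
  set (Th := fun p => exists n, In p (proj1_sig (G n))).
  assert (Hfin : forall d, (forall a, In a d -> Th a) ->
            exists n, incl d (proj1_sig (G n))).
  { induction d as [|a d IH]; intros H; [exists 0; intros _ []|].
    destruct IH as [n Hn]; [intros; apply H; now right|].
    destruct (H a) as [m Hm]; [now left|]. exists (n + m).
    intros x [<-|Hx]; [apply (Hmono m)|apply (Hmono n)]; auto; lia. }
  assert (Hset : forall p, exists n, settles (proj1_sig (G n)) p).
  { intros p. destruct (He p) as [n <-]. exists (S n). apply HS. }
  assert (Hcon : forall d, (forall a, In a d -> Th a) -> consistent d).
  { intros d Hd D. destruct (Hfin d Hd) as [n Hn].
    apply (proj2_sig (G n)). eapply prv_weaken; eauto. }
  assert (Hno : forall p, Th p -> Th (Not p) -> False).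
  { intros p P N. apply (Hcon [p; Not p]).
    - intros a [<-|[<-|[]]]; assumption.
    - eapply P_impE; apply P_hyp; [right|]; now left. }
  exists Th. split; [|intros p Hp; now exists 0]. split.
  - intros d p Hd D. destruct (Hset p) as [n [N|N]]; [|now exists n].
    exfalso. apply (Hcon (Not p :: d)).
    + intros a [<-|Ha]; [now exists n|now apply Hd].
    + eapply P_impE; [apply P_hyp; now left|].
      apply (prv_weaken _ _ _ D). intros x Hx; now right.
  - intros B. apply (Hcon [Bot]); [now intros a [<-|[]]|apply P_hyp; now left].
  - intros p. destruct (Hset p) as [n [N|[N _]]]; [right|left]; now exists n.
  - intros p Hp. destruct (Hset (ExNum p)) as [n [N|(_ & N & _)]].
    + exfalso. eapply Hno; [eassumption|now exists n].
    + destruct (N p eq_refl) as [t Ht]. now exists t, n.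
  - intros p Hp. destruct (Hset (ExStr p)) as [n [N|(_ & _ & N)]].
    + exfalso. eapply Hno; [eassumption|now exists n].
    + destruct (N p eq_refl) as [t Ht]. now exists t, n.
Qed.

End Lindenbaum.

(** * The term model *)

Section TermModel.
Variables T Th : form -> Prop.
Hypothesis H : henkin T Th.

Let ded0 p : prv T [] p -> Th p.
Proof. apply (h_ded _ _ H). now intros a []. Qed.
Let ded1 a p : prv T [a] p -> Th a -> Th p.
Proof. intros D A. apply (h_ded _ _ H) in D; [exact D|]. now intros b [<-|[]]. Qed.
Let ded2 a b p : prv T [a; b] p -> Th a -> Th b -> Th p.
Proof. intros D A B. apply (h_ded _ _ H) in D; [exact D|]. now intros c [<-|[<-|[]]]. Qed.

Lemma Th_imp p q : Th (Imp p q) <-> (Th p -> Th q).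
Proof.
  split.
  - apply ded2. eapply P_impE; apply P_hyp; [now left|right; now left].
  - intros I. destruct (h_dec _ _ H p) as [P|N].
    + apply I in P. revert P. apply ded1, P_impI, P_hyp. right; now left.
    + revert N. apply ded1, P_impI, P_raa. eapply P_impE; apply P_hyp.
      * right; right; now left.
      * right; now left.
Qed.

Lemma Th_not p : Th (Not p) <-> ~ Th p.
Proof.
  unfold Not. rewrite Th_imp. split; intros N P; apply N in P.
  - now apply (h_con _ _ H).
  - destruct P.
Qed.

Lemma Th_and p q : Th (And p q) <-> Th p /\ Th q.
Proof.
  split.
  - intros A; split; revert A; apply ded1; [eapply P_andE1|eapply P_andE2];
      apply P_hyp; now left.
  - intros [P Q]. revert P Q. apply ded2, P_andI; apply P_hyp; [|right]; now left.
Qed.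

Lemma Th_or p q : Th (Or p q) <-> Th p \/ Th q.
Proof.
  split.
  - intros O. destruct (classic (Th p)) as [P|P]; [now left|right].
    apply Th_not in P. revert O P. apply ded2.
    eapply P_orE; [apply P_hyp; now left| |apply P_hyp; now left].
    apply P_raa. eapply P_impE; apply P_hyp; [|right; now left].
    right; right; right; now left.
  - intros [P|Q]; [revert P|revert Q]; apply ded1;
      [apply P_orI1|apply P_orI2]; apply P_hyp; now left.
Qed.

Lemma Th_allN p : Th (AllNum p) <-> forall t, Th (instN p t).
Proof.
  split.
  - intros A t. revert A. apply ded1, P_allNE, P_hyp; now left.
  - intros A. destruct (h_dec _ _ H (AllNum p)) as [P|N]; [exact P|exfalso].
    assert (E : Th (ExNum (Not p))).
    { revert N. apply ded1, P_raa. eapply P_impE; [apply P_hyp; right; now left|].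
      apply P_allNI, P_raa. cbn.
      eapply P_impE; [apply P_hyp; right; now left|].
      apply P_exNI with (NVar 0). apply P_hyp. left.
      unfold instN. cbn. unfold Not. f_equal. symmetry.
      rewrite fsub_comp, <- fsub_id. f_equal; extensionality k; destruct k; reflexivity. }
    apply (h_exN _ _ H) in E as [t E]. apply Th_not in E. apply E, A.
Qed.

Lemma Th_allS p : Th (AllStr p) <-> forall X, Th (instS p X).
Proof.
  split.
  - intros A t. revert A. apply ded1, P_allSE, P_hyp; now left.
  - intros A. destruct (h_dec _ _ H (AllStr p)) as [P|N]; [exact P|exfalso].
    assert (E : Th (ExStr (Not p))).
    { revert N. apply ded1, P_raa. eapply P_impE; [apply P_hyp; right; now left|].
      apply P_allSI, P_raa. cbn.
      eapply P_impE; [apply P_hyp; right; now left|].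
      apply P_exSI with (SVar 0). apply P_hyp. left.
      unfold instS. cbn. unfold Not. f_equal. symmetry.
      rewrite fsub_comp, <- fsub_id. f_equal; extensionality k; destruct k; reflexivity. }
    apply (h_exS _ _ H) in E as [t E]. apply Th_not in E. apply E, A.
Qed.

Lemma Th_exN p : Th (ExNum p) <-> exists t, Th (instN p t).
Proof.
  split; [apply (h_exN _ _ H)|]. intros [t P]. revert P.
  apply ded1, P_exNI with t, P_hyp; now left.
Qed.

Lemma Th_exS p : Th (ExStr p) <-> exists X, Th (instS p X).
Proof.
  split; [apply (h_exS _ _ H)|]. intros [t P]. revert P.
  apply ded1, P_exSI with t, P_hyp; now left.
Qed.

Lemma Th_reflN t : Th (EqN t t).
Proof. apply ded0, P_eqN_refl. Qed.
Lemma Th_reflS X : Th (EqS X X).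
Proof. apply ded0, P_eqS_refl. Qed.

Lemma Th_substN p s t : Th (EqN s t) -> Th (instN p s) -> Th (instN p t).
Proof.
  apply ded2. eapply P_eqN_subst; apply P_hyp; [|right]; now left.
Qed.
Lemma Th_substS p X Y : Th (EqS X Y) -> Th (instS p X) -> Th (instS p Y).
Proof.
  apply ded2. eapply P_eqS_subst; apply P_hyp; [|right]; now left.
Qed.

Ltac red_inst := cbn; rewrite ?nsub_scons_lift, ?ssub_scons_lift,
  ?nsub_scons_liftS, ?ssub_scons_liftS.

Lemma Th_symN s t : Th (EqN s t) -> Th (EqN t s).
Proof.
  intros E. pose proof (Th_substN (EqN (NVar 0) (nsub shN SVar s)) s t E) as S.
  revert S. red_inst. intros S. apply S, Th_reflN.
Qed.
Lemma Th_symS s t : Th (EqS s t) -> Th (EqS t s).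
Proof.
  intros E. pose proof (Th_substS (EqS (SVar 0) (ssub NVar shS s)) s t E) as S.
  revert S. red_inst. intros S. apply S, Th_reflS.
Qed.
Lemma Th_transN s t u : Th (EqN s t) -> Th (EqN t u) -> Th (EqN s u).
Proof.
  intros E F. pose proof (Th_substN (EqN (nsub shN SVar s) (NVar 0)) t u F) as S.
  revert S. red_inst. auto.
Qed.
Lemma Th_transS s t u : Th (EqS s t) -> Th (EqS t u) -> Th (EqS s u).
Proof.
  intros E F. pose proof (Th_substS (EqS (ssub NVar shS s) (SVar 0)) t u F) as S.
  revert S. red_inst. auto.
Qed.

(** A representative of the class of provably equal terms.  The chosen value
    depends only on the class, as equal terms satisfy the same predicate; with
    the representatives as elements, equality in the model is identity. *)
Definition clsN (t : nterm) : nterm :=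
  epsilon (inhabits NZero) (fun u => Th (EqN t u)).
Definition clsS (X : sterm) : sterm :=
  epsilon (inhabits Empty) (fun Y => Th (EqS X Y)).

Lemma clsN_spec t : Th (EqN t (clsN t)).
Proof.
  exact (epsilon_spec (inhabits NZero) (fun u => Th (EqN t u))
           (ex_intro _ t (Th_reflN t))).
Qed.
Lemma clsS_spec t : Th (EqS t (clsS t)).
Proof.
  exact (epsilon_spec (inhabits Empty) (fun u => Th (EqS t u))
           (ex_intro _ t (Th_reflS t))).
Qed.

Lemma clsN_eq s t : Th (EqN s t) -> clsN s = clsN t.
Proof.
  intros E. unfold clsN. f_equal. extensionality u.
  apply propositional_extensionality.
  split; apply Th_transN; [now apply Th_symN|assumption].
Qed.
Lemma clsS_eq s t : Th (EqS s t) -> clsS s = clsS t.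
Proof.
  intros E. unfold clsS. f_equal. extensionality u.
  apply propositional_extensionality.
  split; apply Th_transS; [now apply Th_symS|assumption].
Qed.

Definition qnum := {t | clsN t = t}.
Definition qstr := {X | clsS X = X}.
Definition toN (t : nterm) : qnum :=
  exist _ (clsN t) (eq_sym (clsN_eq _ _ (clsN_spec t))).
Definition toS (X : sterm) : qstr :=
  exist _ (clsS X) (eq_sym (clsS_eq _ _ (clsS_spec X))).

Lemma toN_val (x : qnum) : toN (proj1_sig x) = x.
Proof.
  destruct x as [t E]. apply subset_eq_compat. exact E.
Qed.
Lemma toS_val (x : qstr) : toS (proj1_sig x) = x.
Proof.
  destruct x as [t E]. apply subset_eq_compat. exact E.
Qed.
Lemma toN_eq s t : toN s = toN t <-> Th (EqN s t).
Proof.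
  split; intros E.
  - injection E as E. apply Th_transN with (clsN s); [apply clsN_spec|].
    rewrite E. apply Th_symN, clsN_spec.
  - apply subset_eq_compat, clsN_eq, E.
Qed.
Lemma toS_eq s t : toS s = toS t <-> Th (EqS s t).
Proof.
  split; intros E.
  - injection E as E. apply Th_transS with (clsS s); [apply clsS_spec|].
    rewrite E. apply Th_symS, clsS_spec.
  - apply subset_eq_compat, clsS_eq, E.
Qed.

Lemma rewN (p : form) t : Th (instN p (clsN t)) <-> Th (instN p t).
Proof.
  split; apply Th_substN; [apply Th_symN|]; apply clsN_spec.
Qed.
Lemma rewS (p : form) t : Th (instS p (clsS t)) <-> Th (instS p t).
Proof.
  split; apply Th_substS; [apply Th_symS|]; apply clsS_spec.
Qed.

Local Notation vN := (@proj1_sig nterm (fun t => clsN t = t)).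
Local Notation vS := (@proj1_sig sterm (fun t => clsS t = t)).

Definition term_model : structure := {|
  num := qnum; str := qstr;
  zeroM := toN NZero; oneM := toN NOne;
  addM x y := toN (NAdd (vN x) (vN y)); mulM x y := toN (NMul (vN x) (vN y));
  lenM X := toN (Len (vS X)); sgM X := toN (Sg (vS X));
  tauM X := toN (Tau (vS X)); lhM X := toN (Lh (vS X));
  eltM X i := toN (Elt (vS X) (vN i));
  tauAM X Y := toS (TauA (vS X) (vS Y)); tauBM X Y := toS (TauB (vS X) (vS Y));
  emptyM := toS Empty; nodeM X := toS (Node (vS X));
  delM X i := toS (Del (vS X) (vN i)); posM X Y := toS (Pos (vS X) (vS Y));
  preM X i := toS (Pre (vS X) (vN i)); snocM X i := toS (Snoc (vS X) (vN i));
  leM x y := Th (Le (vN x) (vN y)); memM x X := Th (Mem (vN x) (vS X)) |}.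

(** In this lemma and the next three, u' is the function u of terms written as
    a term with a hole. *)
Lemma congN (u : nterm -> nterm) (u' : nterm) t :
  (forall t, nsub (scons t NVar) SVar u' = u t) -> toN (u (clsN t)) = toN (u t).
Proof.
  intros E. apply toN_eq. pose proof (rewN (EqN u' (nsub shN SVar (u t))) t) as R.
  revert R. red_inst. rewrite !E. intros R. apply R, Th_reflN.
Qed.
Lemma congSN (u : sterm -> nterm) (u' : nterm) t :
  (forall t, nsub NVar (scons t SVar) u' = u t) -> toN (u (clsS t)) = toN (u t).
Proof.
  intros E. apply toN_eq. pose proof (rewS (EqN u' (nsub NVar shS (u t))) t) as R.
  revert R. red_inst. rewrite !E. intros R. apply R, Th_reflN.
Qed.
Lemma congNS (u : nterm -> sterm) (u' : sterm) t :
  (forall t, ssub (scons t NVar) SVar u' = u t) -> toS (u (clsN t)) = toS (u t).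
Proof.
  intros E. apply toS_eq. pose proof (rewN (EqS u' (ssub shN SVar (u t))) t) as R.
  revert R. red_inst. rewrite !E. intros R. apply R, Th_reflS.
Qed.
Lemma congS (u : sterm -> sterm) (u' : sterm) t :
  (forall t, ssub NVar (scons t SVar) u' = u t) -> toS (u (clsS t)) = toS (u t).
Proof.
  intros E. apply toS_eq. pose proof (rewS (EqS u' (ssub NVar shS (u t))) t) as R.
  revert R. red_inst. rewrite !E. intros R. apply R, Th_reflS.
Qed.

Ltac solve_inst := intros; red_inst; reflexivity.

Lemma term_model_ev f g :
  (forall t, evN term_model (fun k => toN (f k)) (fun k => toS (g k)) t
             = toN (nsub f g t)) /\
  (forall X, evS term_model (fun k => toN (f k)) (fun k => toS (g k)) X
             = toS (ssub f g X)).
Proof.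
  apply term_mut; intros; cbn; try reflexivity;
    repeat match goal with E : _ = _ |- _ => rewrite E; clear E end; cbn.
  - rewrite (congN (fun x => NAdd x _) (NAdd (NVar 0) (nsub shN SVar _))) by solve_inst.
    now rewrite (congN (fun x => NAdd _ x) (NAdd (nsub shN SVar _) (NVar 0))) by solve_inst.
  - rewrite (congN (fun x => NMul x _) (NMul (NVar 0) (nsub shN SVar _))) by solve_inst.
    now rewrite (congN (fun x => NMul _ x) (NMul (nsub shN SVar _) (NVar 0))) by solve_inst.
  - now rewrite (congSN Len (Len (SVar 0))) by solve_inst.
  - now rewrite (congSN Sg (Sg (SVar 0))) by solve_inst.
  - now rewrite (congSN Tau (Tau (SVar 0))) by solve_inst.
  - now rewrite (congSN Lh (Lh (SVar 0))) by solve_inst.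
  - rewrite (congSN (fun x => Elt x _) (Elt (SVar 0) (nsub NVar shS _))) by solve_inst.
    now rewrite (congN (fun x => Elt _ x) (Elt (ssub shN SVar _) (NVar 0))) by solve_inst.
  - rewrite (congS (fun x => TauA x _) (TauA (SVar 0) (ssub NVar shS _))) by solve_inst.
    now rewrite (congS (fun x => TauA _ x) (TauA (ssub NVar shS _) (SVar 0))) by solve_inst.
  - rewrite (congS (fun x => TauB x _) (TauB (SVar 0) (ssub NVar shS _))) by solve_inst.
    now rewrite (congS (fun x => TauB _ x) (TauB (ssub NVar shS _) (SVar 0))) by solve_inst.
  - now rewrite (congS Node (Node (SVar 0))) by solve_inst.
  - rewrite (congS (fun x => Del x _) (Del (SVar 0) (nsub NVar shS _))) by solve_inst.
    now rewrite (congNS (fun x => Del _ x) (Del (ssub shN SVar _) (NVar 0))) by solve_inst.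
  - rewrite (congS (fun x => Pos x _) (Pos (SVar 0) (ssub NVar shS _))) by solve_inst.
    now rewrite (congS (fun x => Pos _ x) (Pos (ssub NVar shS _) (SVar 0))) by solve_inst.
  - rewrite (congS (fun x => Pre x _) (Pre (SVar 0) (nsub NVar shS _))) by solve_inst.
    now rewrite (congNS (fun x => Pre _ x) (Pre (ssub shN SVar _) (NVar 0))) by solve_inst.
  - rewrite (congS (fun x => Snoc x _) (Snoc (SVar 0) (nsub NVar shS _))) by solve_inst.
    now rewrite (congNS (fun x => Snoc _ x) (Snoc (ssub shN SVar _) (NVar 0))) by solve_inst.
Qed.

Lemma scons_toN t f : scons (toN t) (fun k => toN (f k)) = fun k => toN (scons t f k).
Proof. extensionality k; destruct k; reflexivity. Qed.
Lemma scons_toS t f : scons (toS t) (fun k => toS (f k)) = fun k => toS (scons t f k).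
Proof. extensionality k; destruct k; reflexivity. Qed.

(** Quantifiers are instantiated by arbitrary terms, so the induction has to be
    over all substitutions at once. *)
Lemma term_model_sat p : forall f g,
  sat term_model (fun k => toN (f k)) (fun k => toS (g k)) p <-> Th (fsub f g p).
Proof.
  assert (AN : forall P : qnum -> Prop, (forall x, P x) <-> forall t, P (toN t)).
  { intros P; split; [auto|]. intros A x. rewrite <- toN_val. apply A. }
  assert (AS : forall P : qstr -> Prop, (forall x, P x) <-> forall t, P (toS t)).
  { intros P; split; [auto|]. intros A x. rewrite <- toS_val. apply A. }
  assert (XN : forall P : qnum -> Prop, (exists x, P x) <-> exists t, P (toN t)).
  { intros P; split; [|firstorder]. intros [x A]. exists (proj1_sig x).
    now rewrite toN_val. }
  assert (XS : forall P : qstr -> Prop, (exists x, P x) <-> exists t, P (toS t)).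
  { intros P; split; [|firstorder]. intros [x A]. exists (proj1_sig x).
    now rewrite toS_val. }
  induction p; intros f g; cbn;
    rewrite ?(proj1 (term_model_ev f g)), ?(proj2 (term_model_ev f g)).
  - split; [intros []|apply (h_con _ _ H)].
  - apply toN_eq.
  - apply toS_eq.
  - cbn. pose proof (rewN (Le (NVar 0) (nsub shN SVar (clsN (nsub f g t)))) (nsub f g s)) as A.
    pose proof (rewN (Le (nsub shN SVar (nsub f g s)) (NVar 0)) (nsub f g t)) as B.
    revert A B. red_inst. tauto.
  - cbn. pose proof (rewN (Mem (NVar 0) (ssub shN SVar (clsS (ssub f g X)))) (nsub f g t)) as A.
    pose proof (rewS (Mem (nsub NVar shS (nsub f g t)) (SVar 0)) (ssub f g X)) as B.
    revert A B. red_inst. tauto.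
  - now rewrite Th_and, IHp1, IHp2.
  - now rewrite Th_or, IHp1, IHp2.
  - now rewrite Th_imp, IHp1, IHp2.
  - rewrite Th_allN, AN. apply Morphisms_Prop.all_iff_morphism. intros t.
    rewrite scons_toN, IHp. fold (upN f). now rewrite instN_up.
  - rewrite Th_exN, XN. apply Morphisms_Prop.ex_iff_morphism. intros t.
    rewrite scons_toN, IHp. fold (upN f). now rewrite instN_up.
  - rewrite Th_allS, AS. apply Morphisms_Prop.all_iff_morphism. intros t.
    rewrite scons_toS, IHp. fold (upS g). now rewrite instS_up.
  - rewrite Th_exS, XS. apply Morphisms_Prop.ex_iff_morphism. intros t.
    rewrite scons_toS, IHp. fold (upS g). now rewrite instS_up.
Qed.

Lemma term_model_models : models term_model T.
Proof.
  intros p Hp r s.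
  replace r with (fun k => toN (proj1_sig (r k)))
    by (extensionality k; apply toN_val).
  replace s with (fun k => toS (proj1_sig (s k)))
    by (extensionality k; apply toS_val).
  apply term_model_sat, ded0, prv_sub, P_ax, Hp.
Qed.

End TermModel.

Theorem completeness T p :
  (forall M, models M T -> forall r s, sat M r s p) -> proves T p.
Proof.
  intros V. apply NNPP. intros N.
  assert (C : consistent T [Not p]) by (intros D; now apply N, P_raa).
  apply lindenbaum in C as (Th & H & I).
  pose proof (V _ (term_model_models T Th H)
    (fun k => toN T Th H (NVar k)) (fun k => toS T Th H (SVar k))) as S.
  apply term_model_sat in S. rewrite fsub_id in S.
  apply (Th_not T Th H) in S; [exact S|]. apply I. now left.
Qed.

(** * Comprehension and induction in a model *)

Declare Scope M_scope.
Delimit Scope M_scope with M.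

Definition list_env {A : Type} (d : A) (l : list A) : nat -> A := fun k => nth k l d.

Lemma Sigma0B_fsub p : Sigma0B p -> forall f g, Sigma0B (fsub f g p).
Proof.
  assert (E : forall f g t, nsub (upN f) (fun k => ssub shN SVar (g k)) (nsub shN SVar t)
                            = nsub shN SVar (nsub f g t)).
  { intros. now rewrite !nsub_comp. }
  induction 1; intros f g; cbn; fold (upN f); rewrite ?E; constructor; auto.
Qed.

Section Model.
Variable M : structure.
Hypothesis HM : models M VNK.

Local Notation N := (num M).
Local Notation S := (str M).
Local Notation "0" := (zeroM M) : M_scope.
Local Notation "1" := (oneM M) : M_scope.
Local Notation "x + y" := (addM M x y) : M_scope.
Local Notation "x * y" := (mulM M x y) : M_scope.
Local Notation "x <= y" := (leM M x y) : M_scope.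
Local Notation "x < y" := (leM M x y /\ x <> y) : M_scope.
Local Notation "x ∈ X" := (memM M x X) : M_scope.
Local Open Scope M_scope.

Local Notation nums := (list_env 0).
Local Notation strs := (list_env (emptyM M)).

(** Comprehension and induction are stated for predicates rather than for
    formulas.  In p, [NVar 0] is the argument and the parameters start at
    [NVar 2]; [NVar 1] is the bound in the comprehension axiom, on which the
    truth value must not depend. *)
Definition definable (P : N -> Prop) : Prop :=
  exists p r s, Sigma0B p /\
    forall a y, sat M (scons y (scons a r)) s p <-> P y.

Lemma comprehension P a : definable P ->
  exists X, lenM M X <= a /\ forall y, y < a -> (y ∈ X <-> P y).
Proof.
  intros (p & r & s & Hp & E).
  destruct (HM _ (VNK_comp p Hp) (scons a r) s) as [X [L HX]].
  exists X. split; [exact L|]. intros y Hy. specialize (HX y Hy).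
  unfold liftS in HX. cbn in HX. rewrite sat_sub in HX. cbn in HX. rewrite <- (E a y).
  exact HX.
Qed.

Lemma succ_ne_0 x : x + 1 <> 0.
Proof. exact (HM _ (VNK_LA2 _ B1) (nums (x :: nil)) (strs nil)). Qed.
Lemma succ_inj x y : x + 1 = y + 1 -> x = y.
Proof. exact (HM _ (VNK_LA2 _ B2) (nums (x :: y :: nil)) (strs nil)). Qed.
Lemma add_0_r x : x + 0 = x.
Proof. exact (HM _ (VNK_LA2 _ B3) (nums (x :: nil)) (strs nil)). Qed.
Lemma add_succ_r x y : x + (y + 1) = (x + y) + 1.
Proof. exact (HM _ (VNK_LA2 _ B4) (nums (x :: y :: nil)) (strs nil)). Qed.
Lemma mul_0_r x : x * 0 = 0.
Proof. exact (HM _ (VNK_LA2 _ B5) (nums (x :: nil)) (strs nil)). Qed.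
Lemma mul_succ_r x y : x * (y + 1) = (x * y) + x.
Proof. exact (HM _ (VNK_LA2 _ B6) (nums (x :: y :: nil)) (strs nil)). Qed.
Lemma le_antisym x y : x <= y /\ y <= x -> x = y.
Proof. exact (HM _ (VNK_LA2 _ B7) (nums (x :: y :: nil)) (strs nil)). Qed.
Lemma le_add_r x y : x <= x + y.
Proof. exact (HM _ (VNK_LA2 _ B8) (nums (x :: y :: nil)) (strs nil)). Qed.
Lemma le_0_l x : 0 <= x.
Proof. exact (HM _ (VNK_LA2 _ B9) (nums (x :: nil)) (strs nil)). Qed.
Lemma le_total x y : x <= y \/ y <= x.
Proof. exact (HM _ (VNK_LA2 _ B10) (nums (x :: y :: nil)) (strs nil)). Qed.
Lemma le_lt_succ x y : x <= y <-> x < y + 1.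
Proof. exact (HM _ (VNK_LA2 _ B11) (nums (x :: y :: nil)) (strs nil)). Qed.
Lemma pred_exists x : x <> 0 -> exists y, y <= x /\ y + 1 = x.
Proof. exact (HM _ (VNK_LA2 _ B12) (nums (x :: nil)) (strs nil)). Qed.
Lemma mem_lt_len X y : y ∈ X -> y < lenM M X.
Proof. exact (HM _ (VNK_LA2 _ L1) (nums (y :: nil)) (strs (X :: nil))). Qed.
Lemma pred_len_mem X y : y + 1 = lenM M X -> y ∈ X.
Proof. exact (HM _ (VNK_LA2 _ L2) (nums (y :: nil)) (strs (X :: nil))). Qed.
Lemma str_ext_len X Y : lenM M X = lenM M Y /\
  (forall x, x < lenM M X -> (x ∈ X <-> x ∈ Y)) -> X = Y.
Proof. exact (HM _ (VNK_LA2 _ SE) (nums nil) (strs (X :: Y :: nil))). Qed.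

Lemma le_refl x : x <= x.
Proof. destruct (le_total x x); assumption. Qed.

Lemma le_succ_cases x y : x <= y + 1 -> x <= y \/ x = y + 1.
Proof.
  intros L. destruct (classic (x = y + 1)) as [E|E]; [now right|left].
  now apply le_lt_succ.
Qed.

Lemma le_zero x : x <= 0 -> x = 0.
Proof. intros L. apply le_antisym. split; [exact L|apply le_0_l]. Qed.

Lemma lt_succ_le x : x < x + 1.
Proof. apply le_lt_succ, le_refl. Qed.

Lemma definable_below P : definable P -> definable (fun z => forall y, y <= z -> P y).
Proof.
  intros (p & r & s & Hp & E).
  set (f := scons (NVar O) (fun k => NVar (Datatypes.S (Datatypes.S k)))).
  exists (AllLe (NVar O) (fsub f SVar p)), r, s. split.
  - apply S0_AllLe, Sigma0B_fsub, Hp.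
  - intros a y. cbn. apply Morphisms_Prop.all_iff_morphism. intros x.
    rewrite sat_sub, <- (E a x).
    replace (fun k => evN M (scons x (scons y (scons a r))) s (f k))
      with (scons x (scons a r)); [reflexivity|].
    extensionality k. destruct k; reflexivity.
Qed.

(** Let X consist of the z < a + 1 such that P holds up to z.  If |X| = x + 1,
    then x is in X, and unless x = a, P holds up to x + 1 too, so x + 1 is in X
    although it is the length of X.  The order is not known to be transitive
    here, as that is itself proved by induction. *)
Lemma induction P : definable P -> P 0 -> (forall y, P y -> P (y + 1)) ->
  forall y, P y.
Proof.
  intros D P0 PS a.
  destruct (comprehension _ (a + 1) (definable_below P D)) as (X & L & HX).
  destruct (classic (lenM M X = 0)) as [Z|Z].
  - assert (I : 0 ∈ X).
    { apply HX; [apply le_lt_succ, le_0_l|]. intros y Ly. apply le_zero in Ly as ->. exact P0. }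
    apply mem_lt_len in I as [_ I]. now rewrite Z in I.
  - apply pred_exists in Z as (x & _ & E). pose proof (pred_len_mem _ _ E) as I.
    rewrite <- E in L. apply le_succ_cases in L as [L|L].
    + assert (Lx : x <= a).
      { destruct (le_total x a) as [H|H]; [exact H|exfalso].
        apply le_lt_succ in H as [H1 H2]. now apply H2, le_antisym. }
      assert (I' : x + 1 ∈ X).
      { apply HX; [now apply le_lt_succ|]. intros y Ly.
        assert (Px : forall y, y <= x -> P y) by (apply HX; [now apply le_lt_succ|exact I]).
        apply le_succ_cases in Ly as [Ly| ->]; [now apply Px|apply PS, Px, le_refl]. }
      apply mem_lt_len in I' as [_ I']. now rewrite E in I'.
    + apply succ_inj in L as ->.
      apply (HX a); [apply lt_succ_le|exact I|apply le_refl].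
Qed.

(** Proves definability of a predicate from a formula and its parameters. *)
Ltac solve_definable p r s :=
  exists p, (nums r), (strs s); split; [repeat constructor|intros; cbn; reflexivity].

Local Notation "$ k" := (NVar k) (at level 0).

(** * Arithmetic in a model *)

Lemma add_0_l x : 0 + x = x.
Proof.
  revert x. apply induction.
  - solve_definable (0 + $0 == $0)%fm (@nil N) (@nil S).
  - apply add_0_r.
  - intros y IH. now rewrite add_succ_r, IH.
Qed.

Lemma add_succ_l x y : (x + 1) + y = (x + y) + 1.
Proof.
  revert y. apply induction.
  - solve_definable (($2 + 1) + $0 == ($2 + $0) + 1)%fm (x :: nil) (@nil S).
  - now rewrite !add_0_r.
  - intros y IH. now rewrite !add_succ_r, IH.
Qed.

Lemma add_comm x y : x + y = y + x.
Proof.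
  revert y. apply induction.
  - solve_definable ($2 + $0 == $0 + $2)%fm (x :: nil) (@nil S).
  - now rewrite add_0_r, add_0_l.
  - intros y IH. now rewrite add_succ_r, add_succ_l, IH.
Qed.

Lemma add_assoc x y z : x + (y + z) = (x + y) + z.
Proof.
  revert z. apply induction.
  - solve_definable ($2 + ($3 + $0) == ($2 + $3) + $0)%fm (x :: y :: nil) (@nil S).
  - now rewrite !add_0_r.
  - intros z IH. now rewrite !add_succ_r, IH.
Qed.

Lemma mul_0_l x : 0 * x = 0.
Proof.
  revert x. apply induction.
  - solve_definable (0 * $0 == 0)%fm (@nil N) (@nil S).
  - apply mul_0_r.
  - intros y IH. now rewrite mul_succ_r, IH, add_0_r.
Qed.

Lemma mul_succ_l x y : (x + 1) * y = x * y + y.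
Proof.
  revert y. apply induction.
  - solve_definable (($2 + 1) * $0 == $2 * $0 + $0)%fm (x :: nil) (@nil S).
  - now rewrite !mul_0_r, add_0_r.
  - intros y IH. rewrite !mul_succ_r, IH, !add_succ_r, <- !(add_assoc (x * y)), (add_comm y). reflexivity.
Qed.

Lemma mul_comm x y : x * y = y * x.
Proof.
  revert y. apply induction.
  - solve_definable ($2 * $0 == $0 * $2)%fm (x :: nil) (@nil S).
  - now rewrite mul_0_r, mul_0_l.
  - intros y IH. now rewrite mul_succ_r, mul_succ_l, IH.
Qed.

Lemma mul_add_r x y z : x * (y + z) = x * y + x * z.
Proof.
  revert z. apply induction.
  - solve_definable ($2 * ($3 + $0) == $2 * $3 + $2 * $0)%fm (x :: y :: nil) (@nil S).
  - now rewrite mul_0_r, !add_0_r.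
  - intros z IH. now rewrite add_succ_r, !mul_succ_r, IH, add_assoc.
Qed.

Lemma mul_assoc x y z : x * (y * z) = (x * y) * z.
Proof.
  revert z. apply induction.
  - solve_definable ($2 * ($3 * $0) == ($2 * $3) * $0)%fm (x :: y :: nil) (@nil S).
  - now rewrite !mul_0_r.
  - intros z IH. now rewrite !mul_succ_r, mul_add_r, IH.
Qed.

Lemma num_semiring : semi_ring_theory 0 1 (addM M) (mulM M) eq.
Proof.
  split; intros.
  - apply add_0_l.
  - apply add_comm.
  - apply add_assoc.
  - now rewrite <- (add_0_l 1), mul_succ_l, mul_0_l, add_0_l.
  - apply mul_0_l.
  - apply mul_comm.
  - apply mul_assoc.
  - now rewrite mul_comm, mul_add_r, !(mul_comm p).
Qed.
Add Ring num_ring : num_semiring.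

Lemma add_cancel x y z : x + z = y + z -> x = y.
Proof.
  revert z. apply (induction (fun z => x + z = y + z -> x = y)).
  - solve_definable ($2 + $0 == $3 + $0 → $2 == $3)%fm (x :: y :: nil) (@nil S).
  - now rewrite !add_0_r.
  - intros z IH. rewrite !add_succ_r. intros E. now apply IH, succ_inj.
Qed.

Lemma le_ex x y : x <= y <-> exists z, x + z = y.
Proof.
  split; [|intros [z <-]; apply le_add_r].
  intros L. enough (H : exists z, z <= y /\ x + z = y)
    by (destruct H as (z & _ & E); now exists z).
  revert y L. apply (induction (fun y => x <= y -> exists z, z <= y /\ x + z = y)).
  - solve_definable ($2 <= $0 → ExLe $0 ($3 + $0 == $1))%fm (x :: nil) (@nil S).
  - intros L. apply le_zero in L as ->. exists 0. split; [apply le_refl|ring].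
  - intros y IH L. apply le_succ_cases in L as [L| ->].
    + destruct (IH L) as (z & _ & <-). exists (z + 1).
      split; [rewrite <- add_assoc, (add_comm x); apply le_add_r|ring].
    + exists 0. split; [apply le_0_l|ring].
Qed.

Lemma lt_ex x y : x < y <-> exists z, x + z + 1 = y.
Proof.
  split.
  - intros [L Q]. apply le_ex in L as [z <-].
    destruct (classic (z = 0)) as [->|Z]; [now rewrite add_0_r in Q|].
    apply pred_exists in Z as (w & _ & <-). exists w. ring.
  - intros [z <-]. apply le_lt_succ, le_add_r.
Qed.

Lemma not_add_succ x z : x + z + 1 <> x.
Proof.
  intros E. apply (succ_ne_0 z), (add_cancel _ _ x). rewrite add_0_l. rewrite <- E at 2. ring.
Qed.

Lemma lt_ge_cases x y : x < y \/ y <= x.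
Proof.
  destruct (classic (x = y)) as [->|Q]; [right; apply le_refl|].
  destruct (le_total x y); [left|right]; auto.
Qed.

Lemma le_trans x y z : x <= y -> y <= z -> x <= z.
Proof. intros [a <-]%le_ex [b <-]%le_ex. apply le_ex. exists (a + b). ring. Qed.

Lemma lt_le_trans x y z : x < y -> y <= z -> x < z.
Proof. intros [a <-]%lt_ex [b <-]%le_ex. apply lt_ex. exists (a + b). ring. Qed.

Lemma le_lt_trans x y z : x <= y -> y < z -> x < z.
Proof. intros [a <-]%le_ex [b <-]%lt_ex. apply lt_ex. exists (a + b). ring. Qed.

Lemma le_not_lt x y : x <= y -> y < x -> False.
Proof. intros L [Q R]. now apply R, le_antisym. Qed.

Lemma definable_not P : definable P -> definable (fun y => ~ P y).
Proof.
  intros (p & r & s & Hp & E). exists (¬ p)%fm, r, s. split.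
  - constructor; [exact Hp|constructor].
  - intros a y. cbn. now rewrite E.
Qed.

Lemma least P : definable P -> forall y, P y ->
  exists x, P x /\ x <= y /\ forall z, z < x -> ~ P z.
Proof.
  intros D y Py. apply NNPP. intros No.
  assert (A : forall x, (forall z, z < x -> ~ P z) -> ~ P x).
  { intros x Hx Px. apply No. exists x. split; [exact Px|]. split; [|exact Hx].
    destruct (lt_ge_cases y x) as [L|L]; [now apply Hx in L|exact L]. }
  enough (B : forall z x, x <= z -> ~ P x) by exact (B y y (le_refl y) Py).
  apply (induction (fun z => forall x, x <= z -> ~ P x)).
  - apply (definable_below (fun x => ~ P x)), definable_not, D.
  - intros x L. apply le_zero in L as ->. apply A. intros z L.
    now apply le_not_lt in L; [|apply le_0_l].
  - intros z IH x L. apply le_succ_cases in L as [L| ->]; [now apply IH|].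
    apply A. intros w Lw. apply le_lt_succ in Lw. now apply IH.
Qed.

(** * Pairs *)

Definition pairM (u v : N) : N := ((u + v) * ((u + v) + 1) + (v + v)).

(** Pairs are ordered first by their sum: s(s + 1) + 2v with v <= s stays below
    (s + 1)(s + 2). *)
Lemma pairM_lt_sum u v u' v' : u + v < u' + v' -> pairM u v < pairM u' v'.
Proof.
  intros [z E]%lt_ex. apply lt_ex.
  (* With u' + v' = u + v + z + 1 this is <u', v'> - <u, v> - 1. *)
  exists ((u + v + (u + v)) * z + (u + u) + z * z + z + z + z + 1 + (v' + v')).
  unfold pairM. rewrite <- E. ring.
Qed.

Lemma pairM_inj u v u' v' : pairM u v = pairM u' v' -> u = u' /\ v = v'.
Proof.
  intros E.
  assert (Q : u + v = u' + v').
  { destruct (lt_ge_cases (u + v) (u' + v')) as [L|L].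
    - apply pairM_lt_sum in L as [_ L]. now rewrite E in L.
    - apply NNPP. intros Q. assert (L' : u' + v' < u + v) by (split; congruence).
      apply pairM_lt_sum in L' as [_ L']. now rewrite E in L'. }
  assert (D : v + v = v' + v').
  { unfold pairM in E. rewrite <- Q in E.
    apply (add_cancel _ _ ((u + v) * (u + v + 1))). rewrite add_comm, E. ring. }
  assert (V : v = v').
  { destruct (lt_ge_cases v v') as [L|L].
    - apply lt_ex in L as [z <-]. exfalso. apply (not_add_succ (v + v) (z + z + 1)).
      rewrite D at 2. ring.
    - apply le_ex in L as [z <-]. destruct (classic (z = 0)) as [->|Z]; [ring|exfalso].
      apply pred_exists in Z as (w & _ & <-). apply (not_add_succ (v' + v') (w + w + 1)).
      rewrite <- D at 2. ring. }
  split; [|exact V]. subst v'. eapply add_cancel, Q.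
Qed.

Lemma pairM_ge_l u v : u <= pairM u v.
Proof. apply le_ex. exists ((u + v) * (u + v) + v + v + v). unfold pairM. ring. Qed.

Lemma pairM_ge_r u v : v <= pairM u v.
Proof. apply le_ex. exists ((u + v) * (u + v) + u + v + v). unfold pairM. ring. Qed.

Lemma pairM_lt_r u v v' : v < v' -> pairM u v < pairM u v'.
Proof.
  intros [z <-]%lt_ex. apply pairM_lt_sum, lt_ex. exists z. ring.
Qed.

Lemma pairM_lt_diag u v a : u < a -> v < a -> pairM u v < pairM a a.
Proof.
  intros [x E]%lt_ex [y E']%lt_ex. apply pairM_lt_sum, lt_ex.
  exists (x + y + 1). rewrite <- E at 1. rewrite <- E'. ring.
Qed.

Lemma pairM_mono u v u' v' : u <= u' -> v <= v' -> pairM u v <= pairM u' v'.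
Proof.
  intros [x <-]%le_ex [y <-]%le_ex. apply le_ex.
  exists ((u + v) * (x + y) + (x + y) * (u + v + x + y) + (x + y) + (y + y)).
  unfold pairM. ring.
Qed.

(** * Strings and sequences *)

Lemma str_ext X Y : (forall x, x ∈ X <-> x ∈ Y) -> X = Y.
Proof.
  assert (A : forall X Y, (forall x, x ∈ X <-> x ∈ Y) -> lenM M Y <= lenM M X).
  { intros A B E. destruct (lt_ge_cases (lenM M A) (lenM M B)) as [L|L]; [exfalso|exact L].
    destruct (classic (lenM M B = 0)) as [Z|Z].
    - rewrite Z in L. apply (le_not_lt _ _ (le_0_l _) L).
    - apply pred_exists in Z as (z & _ & Z). pose proof (pred_len_mem _ _ Z) as I.
      apply E, mem_lt_len in I. rewrite <- Z in L. apply le_lt_succ in L. now apply le_not_lt in L. }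
  intros E. apply str_ext_len. split; [|intros; apply E].
  apply le_antisym. split; apply A; intros x; now rewrite E.
Qed.

Lemma mem_pairM_l X u v : pairM u v ∈ X -> u < lenM M X.
Proof. intros I. eapply le_lt_trans; [apply pairM_ge_l|apply mem_lt_len, I]. Qed.
Lemma mem_pairM_r X u v : pairM u v ∈ X -> v < lenM M X.
Proof. intros I. eapply le_lt_trans; [apply pairM_ge_r|apply mem_lt_len, I]. Qed.

Lemma not_lt_0 x : ~ x < 0.
Proof. exact (le_not_lt _ _ (le_0_l x)). Qed.

Lemma len_empty : lenM M (emptyM M) = 0.
Proof. exact (HM _ (VNK_defined _ Empty_def) (nums nil) (strs nil)). Qed.

Lemma not_mem_empty x : ~ x ∈ emptyM M.
Proof. intros I. apply mem_lt_len in I. rewrite len_empty in I. now apply not_lt_0 in I. Qed.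

Lemma lh_none W v : ~ pairM (lhM M W) v ∈ W.
Proof.
  destruct (HM _ (VNK_defined _ Lh_def) (nums nil) (strs (W :: nil))) as (_ & A & _).
  cbn in A. intros I. exact (A (mem_pairM_l _ _ _ I) v (mem_pairM_r _ _ _ I) I).
Qed.

Lemma lh_some W i : i < lhM M W -> exists v, pairM i v ∈ W.
Proof.
  destruct (HM _ (VNK_defined _ Lh_def) (nums nil) (strs (W :: nil))) as (_ & _ & A).
  cbn in A. intros L. apply NNPP. intros No. apply (A i L). intros v _ I.
  now apply No; exists v.
Qed.

Lemma lh_eq W h : (forall i, i < h -> exists v, pairM i v ∈ W) ->
  (forall v, ~ pairM h v ∈ W) -> lhM M W = h.
Proof.
  intros A B. apply NNPP. intros Q. destruct (lt_ge_cases (lhM M W) h) as [L|L].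
  - apply A in L as [v I]. now apply lh_none in I.
  - destruct (lh_some W h) as [v I]; [split; congruence|]. now apply B in I.
Qed.

Lemma elt_mem W i v : pairM i v ∈ W -> pairM i (eltM M W i) ∈ W.
Proof.
  intros I.
  destruct (HM _ (VNK_defined _ Elt_def) (nums (i :: nil)) (strs (W :: nil))) as (L & A & B).
  cbn in L, A, B. destruct (classic (eltM M W i = lenM M W)) as [E|E]; [|now apply A].
  exfalso. apply (B v); [|exact I]. rewrite E. apply (mem_pairM_r _ _ _ I).
Qed.

Lemma snoc_iff W v w : w ∈ snocM M W v <-> w ∈ W \/ w = pairM (lhM M W) v.
Proof. exact (HM _ (VNK_defined _ Snoc_def) (nums (w :: v :: nil)) (strs (W :: nil))). Qed.

Lemma pre_iff W i j v : pairM j v ∈ preM M W i <-> pairM j v ∈ W /\ j < i.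
Proof.
  pose proof (HM _ (VNK_defined _ Pre_def) (nums (pairM j v :: i :: nil)) (strs (W :: nil))) as A.
  change ((pairM j v ∈ preM M W i -> pairM j v ∈ W /\
            exists j', j' < i /\ exists v', v' <= pairM j v /\ pairM j v = pairM j' v') /\
          (pairM j v ∈ W /\ (exists j', j' < i /\ exists v', v' <= pairM j v /\ pairM j v = pairM j' v')
             -> pairM j v ∈ preM M W i)) in A.
  destruct A as [A B]. split.
  - intros I. apply A in I as (I & j' & L & v' & _ & E). split; [exact I|].
    now apply pairM_inj in E as [-> ->].
  - intros [I L]. apply B. split; [exact I|]. exists j. split; [exact L|].
    exists v. split; [apply pairM_ge_r|reflexivity].
Qed.

Lemma pre_sub W i w : w ∈ preM M W i -> w ∈ W.
Proof.
  apply (HM _ (VNK_defined _ Pre_def) (nums (w :: i :: nil)) (strs (W :: nil))).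
Qed.

(** [Seq] without its bounds, which hold automatically since the components of a
    pair do not exceed it. *)
Definition seqM (W : S) : Prop :=
  (forall x, x ∈ W -> exists i v, i < lhM M W /\ x = pairM i v) /\
  (forall i v v', pairM i v ∈ W -> pairM i v' ∈ W -> v = v').

Lemma sat_Seq r s X : sat M r s (Seq X) <-> seqM (evS M r s X).
Proof.
  change (Seq X) with (fsub NVar (scons X SVar) (Seq (SVar O))).
  rewrite sat_sub. cbn. generalize (evS M r s X) as W. clear r s X. intros W.
  split.
  - intros [A B]. split.
    + intros x I. destruct (A x (mem_lt_len _ _ I) I) as (i & L & v & _ & E). now exists i, v.
    + intros i v v' I I'.
      assert (L : i < lhM M W).
      { destruct (A _ (mem_lt_len _ _ I) I) as (j & L & w & _ & E).
        now apply pairM_inj in E as [-> _]. }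
      exact (B i L v (mem_pairM_r _ _ _ I) v' (mem_pairM_r _ _ _ I') (conj I I')).
  - intros [A B]. split.
    + intros x _ I. destruct (A x I) as (i & v & L & ->). exists i. split; [exact L|].
      exists v. split; [apply (mem_pairM_r _ _ _ I)|reflexivity].
    + intros i _ v _ v' _ [I I']. now apply (B i).
Qed.

Lemma seq_lt W i v : seqM W -> pairM i v ∈ W -> i < lhM M W.
Proof.
  intros [A _] I. destruct (A _ I) as (j & w & L & E). now apply pairM_inj in E as [-> _].
Qed.

Lemma elt_eq W i v : seqM W -> pairM i v ∈ W -> eltM M W i = v.
Proof. intros [_ A] I. apply (A i); [now apply elt_mem in I|exact I]. Qed.

Lemma seq_empty : seqM (emptyM M).
Proof. split; [intros x I|intros i v v' I]; now apply not_mem_empty in I. Qed.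

Lemma lh_snoc W v : seqM W -> lhM M (snocM M W v) = lhM M W + 1.
Proof.
  intros HW. apply lh_eq.
  - intros i L. apply le_lt_succ in L. destruct (classic (i = lhM M W)) as [->|Q].
    + exists v. apply snoc_iff. now right.
    + destruct (lh_some W i (conj L Q)) as [w I]. exists w. apply snoc_iff. now left.
  - intros w I. apply snoc_iff in I as [I|I].
    + apply seq_lt in I; [|exact HW]. eapply le_not_lt, I. apply le_add_r.
    + apply pairM_inj in I as [I _]. now apply (lt_succ_le (lhM M W)).
Qed.

Lemma seq_snoc W v : seqM W -> seqM (snocM M W v).
Proof.
  intros HW. split.
  - intros x I. rewrite lh_snoc by exact HW. apply snoc_iff in I as [I| ->].
    + destruct HW as [A _]. destruct (A x I) as (i & w & L & ->). exists i, w.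
      split; [|reflexivity]. apply le_lt_succ, L.
    + exists (lhM M W), v. split; [apply lt_succ_le|reflexivity].
  - intros i w w' I I'. apply snoc_iff in I, I'.
    destruct I as [I|I], I' as [I'|I'].
    + destruct HW as [_ B]. now apply (B i).
    + apply pairM_inj in I' as [-> _]. now apply lh_none in I.
    + apply pairM_inj in I as [-> _]. now apply lh_none in I'.
    + apply pairM_inj in I as [_ ->], I' as [_ ->]. reflexivity.
Qed.

Lemma pre_0 W : seqM W -> preM M W 0 = emptyM M.
Proof.
  intros [A _]. apply str_ext. intros x. split; intros I.
  - destruct (A x (pre_sub _ _ _ I)) as (i & v & L & ->).
    apply pre_iff in I as [_ I]. now apply not_lt_0 in I.
  - now apply not_mem_empty in I.
Qed.

Lemma lh_pre W i : i <= lhM M W -> lhM M (preM M W i) = i.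
Proof.
  intros L. apply lh_eq.
  - intros j Lj. destruct (lh_some W j) as [v I]; [now apply lt_le_trans with i|].
    exists v. now apply pre_iff.
  - intros v I. apply pre_iff in I as [_ [_ I]]. now apply I.
Qed.

Lemma seq_pre W i : seqM W -> i <= lhM M W -> seqM (preM M W i).
Proof.
  intros [A B] L. split.
  - intros x I. rewrite lh_pre by exact L. destruct (A x (pre_sub _ _ _ I)) as (j & v & _ & ->).
    exists j, v. split; [|reflexivity]. now apply pre_iff in I.
  - intros j v v' I I'. apply pre_iff in I, I'. now apply (B j).
Qed.

Lemma pre_succ W i : seqM W -> i < lhM M W ->
  preM M W (i + 1) = snocM M (preM M W i) (eltM M W i).
Proof.
  intros HW L. apply str_ext. intros x. rewrite snoc_iff, lh_pre by apply L. split.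
  - intros I. destruct (proj1 HW x (pre_sub _ _ _ I)) as (j & v & _ & ->).
    apply pre_iff in I as [I Lj]. apply le_lt_succ in Lj.
    destruct (classic (j = i)) as [->|Q].
    + right. now rewrite (elt_eq W i v).
    + left. now apply pre_iff.
  - intros [I| ->].
    + destruct (proj1 HW x (pre_sub _ _ _ I)) as (j & v & _ & ->).
      apply pre_iff in I as [I [Lj _]]. apply pre_iff. split; [exact I|]. now apply le_lt_succ.
    + destruct (lh_some W i L) as [v I]. apply pre_iff.
      split; [now apply elt_mem in I|apply lt_succ_le].
Qed.

(** * Graphs and positions *)

Lemma node_iff G u : u ∈ nodeM M G <-> pairM u u ∈ G.
Proof.
  pose proof (HM _ (VNK_defined _ Node_def) (nums (u :: nil)) (strs (G :: nil))) as [A B].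
  split; [intros I; exact (proj2 (A I))|]. intros I. apply B.
  split; [apply (mem_pairM_l _ _ _ I)|exact I].
Qed.

Lemma del_iff G x y z : pairM y z ∈ delM M G x <->
  (y ∈ nodeM M G /\ ~ pairM x y ∈ G) /\ (z ∈ nodeM M G /\ ~ pairM x z ∈ G) /\ pairM y z ∈ G.
Proof.
  pose proof (HM _ (VNK_defined _ Del_def) (nums (pairM y z :: x :: nil)) (strs (G :: nil))) as [A B].
  split.
  - intros I. apply A in I as (y' & _ & z' & _ & E & I). cbn in E.
    apply pairM_inj in E as [-> ->]. exact I.
  - intros I. apply B. exists y. split; [apply pairM_ge_l|]. exists z.
    split; [apply pairM_ge_r|]. split; [reflexivity|exact I].
Qed.

Lemma del_pair G x w : w ∈ delM M G x -> exists y z, w = pairM y z.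
Proof.
  pose proof (HM _ (VNK_defined _ Del_def) (nums (w :: x :: nil)) (strs (G :: nil))) as [A _].
  intros I. apply A in I as (y & _ & z & _ & E & _). now exists y, z.
Qed.

Lemma node_del G x y : y ∈ nodeM M (delM M G x) <-> y ∈ nodeM M G /\ ~ pairM x y ∈ G.
Proof. rewrite !node_iff, del_iff, !node_iff. tauto. Qed.

(** [UGraph] without its bounds. *)
Definition ugraphM (G : S) : Prop :=
  (forall x, x ∈ G -> exists u v, x = pairM u v) /\
  (forall u v, pairM u v ∈ G -> pairM u u ∈ G) /\
  (forall u v, pairM u v ∈ G -> pairM v u ∈ G).

Lemma sat_UGraph r s X : sat M r s (UGraph X) <-> ugraphM (evS M r s X).
Proof.
  change (UGraph X) with (fsub NVar (scons X SVar) (UGraph (SVar O))).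
  rewrite sat_sub. cbn. generalize (evS M r s X) as G. clear r s X. intros G.
  split.
  - intros [[A B] C]. split; [|split].
    + intros x I. destruct (A x (mem_lt_len _ _ I) I) as (u & _ & v & _ & E). now exists u, v.
    + intros u v I. apply (B u (mem_pairM_l _ _ _ I)). exists v.
      split; [apply (mem_pairM_r _ _ _ I)|now left].
    + intros u v I. apply C; [apply (mem_pairM_l _ _ _ I)|apply (mem_pairM_r _ _ _ I)|exact I].
  - intros (A & B & C). split; [split|].
    + intros x _ I. destruct (A x I) as (u & v & ->). exists u.
      split; [apply (mem_pairM_l _ _ _ I)|]. exists v.
      split; [apply (mem_pairM_r _ _ _ I)|reflexivity].
    + intros u _ (v & _ & [I|I]); [|apply C in I]; now apply B in I.
    + intros u _ v _. apply C.
Qed.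

Lemma ugraph_del G x : ugraphM G -> ugraphM (delM M G x).
Proof.
  intros (A & B & C). split; [|split].
  - apply del_pair.
  - intros u v. rewrite !del_iff, !node_iff. tauto.
  - intros u v. rewrite !del_iff. intros (Hu & Hv & I). auto.
Qed.

Lemma pos_empty G : posM M G (emptyM M) = G.
Proof. exact (HM _ (VNK_defined _ Pos_empty) (nums nil) (strs (G :: nil))). Qed.

Lemma pos_legal G W v : seqM W -> v ∈ nodeM M (posM M G W) ->
  posM M G (snocM M W v) = delM M (posM M G W) v.
Proof.
  intros HW. apply (HM _ (VNK_defined _ Pos_legal) (nums (v :: nil)) (strs (G :: W :: nil))).
  now apply sat_Seq.
Qed.

Lemma pos_illegal G W v : seqM W -> ~ v ∈ nodeM M (posM M G W) ->
  posM M G (snocM M W v) = posM M G W.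
Proof.
  intros HW. apply (HM _ (VNK_defined _ Pos_illegal) (nums (v :: nil)) (strs (G :: W :: nil))).
  now apply sat_Seq.
Qed.

(** * Kernels of ordered graphs *)

Lemma separation P a : definable P -> exists X, forall y, y ∈ X <-> y < a /\ P y.
Proof.
  intros D. destruct (comprehension P a D) as (X & L & HX). exists X. intros y. split.
  - intros I. assert (Ly : y < a) by (eapply lt_le_trans, L; apply mem_lt_len, I).
    split; [exact Ly|now apply HX].
  - intros [Ly Py]. now apply HX.
Qed.

Lemma diagonal_sequence a : exists W, seqM W /\ lhM M W = a /\
  forall i, i < a -> eltM M W i = i.
Proof.
  destruct (separation (fun w => exists i, i < a /\ w = pairM i i) (pairM a a)) as [W HW].
  { solve_definable (ExLt $2 ($1 == npair $0 $0))%fm (a :: nil) (@nil S). }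
  assert (E : forall i v, pairM i v ∈ W <-> i < a /\ v = i).
  { intros i v. rewrite HW. split.
    - intros [_ (j & L & Q)]. now apply pairM_inj in Q as [-> ->].
    - intros [L ->]. split; [|now exists i]. now apply pairM_lt_diag. }
  assert (Hlh : lhM M W = a).
  { apply lh_eq; [intros i L; exists i; now apply E|]. intros v I. now apply E in I. }
  assert (HS : seqM W).
  { split.
    - intros x I. apply HW in I as [_ (i & L & ->)]. exists i, i. now rewrite Hlh.
    - intros i v v' I I'. apply E in I as [_ ->], I' as [_ ->]. reflexivity. }
  exists W. split; [exact HS|]. split; [exact Hlh|].
  intros i L. apply (elt_eq _ _ _ HS). now apply E.
Qed.

(** Y is the set of the vertices accepted when 0, 1, ..., a - 1 are played in this
    order on G, an illegal move being ignored.  A move u deletes u and the y with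
    <u, y> in G; hence v is still a node when its turn comes iff no accepted
    u < v has an edge to v.  Only edges from smaller to larger vertices matter,
    so G may be directed. *)
Lemma kernel_exists G a : (forall v, v < a -> pairM v v ∈ G) ->
  exists Y, forall v, v < a ->
    (v ∈ Y <-> forall u, u < v -> u ∈ Y -> ~ pairM u v ∈ G).
Proof.
  intros HG. destruct (diagonal_sequence a) as (W & HW & Hlh & Helt).
  destruct (separation (fun v => v ∈ nodeM M (posM M G (preM M W v))) a) as [Y HY].
  { solve_definable ($0 ∈ Node (Pos (SVar 0) (Pre (SVar 1) $0)))%fm (@nil N) (G :: W :: nil). }
  assert (Inv : forall i, i <= a -> forall y, y < a -> forall z, z < a ->
    (pairM y z ∈ posM M G (preM M W i) <->
     pairM y z ∈ G /\ forall u, u < i -> u ∈ Y -> ~ pairM u y ∈ G /\ ~ pairM u z ∈ G)).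
  { apply (induction (fun i => i <= a -> forall y, y < a -> forall z, z < a ->
    (pairM y z ∈ posM M G (preM M W i) <->
     pairM y z ∈ G /\ forall u, u < i -> u ∈ Y -> ~ pairM u y ∈ G /\ ~ pairM u z ∈ G))).
    - solve_definable ($0 <= $2 → AllLt $2 (AllLt $3
        (npair $1 $0 ∈ Pos (SVar 0) (Pre (SVar 1) $2) ↔
         npair $1 $0 ∈ SVar 0 ∧ AllLt $2 ($0 ∈ SVar 2 →
           ¬ npair $0 $2 ∈ SVar 0 ∧ ¬ npair $0 $1 ∈ SVar 0))))%fm
        (a :: nil) (G :: W :: Y :: nil).
    - intros _ y _ z _. rewrite pre_0, pos_empty by exact HW.
      split; [|intros [I _]; exact I]. intros I. split; [exact I|].
      intros u L. now apply not_lt_0 in L.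
    - intros i IH L y Ly z Lz.
      assert (Li : i < a) by (apply (lt_le_trans _ (i + 1)); [apply lt_succ_le|exact L]).
      specialize (IH (proj1 Li)).
      assert (Hp : seqM (preM M W i)) by (apply seq_pre; [exact HW|rewrite Hlh; apply Li]).
      rewrite pre_succ by (assumption || now rewrite Hlh). rewrite (Helt i Li).
      assert (Hup : forall R : N -> Prop, (forall u, u < i + 1 -> u ∈ Y -> R u) <->
                (forall u, u < i -> u ∈ Y -> R u) /\ (i ∈ Y -> R i)).
      { intros R. split.
        - intros A. split; [|apply A, lt_succ_le]. intros u Lu. apply A, le_lt_succ, Lu.
        - intros [A B] u Lu Iu. apply le_lt_succ in Lu.
          destruct (classic (u = i)) as [->|Q]; [now apply B|now apply A]. }
      rewrite (Hup (fun u => ~ pairM u y ∈ G /\ ~ pairM u z ∈ G)).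
      assert (Hi : i ∈ Y <-> i ∈ nodeM M (posM M G (preM M W i)))
        by (rewrite HY; tauto).
      assert (Hn : forall v, v < a -> (v ∈ nodeM M (posM M G (preM M W i)) <->
                 forall u, u < i -> u ∈ Y -> ~ pairM u v ∈ G)).
      { intros v Lv. rewrite node_iff, (IH v Lv v Lv). split.
        - intros [_ A] u Lu Iu. now apply (A u).
        - intros A. split; [now apply HG|]. intros u Lu Iu. split; now apply A. }
      destruct (classic (i ∈ Y)) as [I|I].
      + rewrite pos_legal by (assumption || now apply Hi).
        rewrite del_iff, (Hn y Ly), (Hn z Lz), (IH i Li y Ly), (IH i Li z Lz), (IH y Ly z Lz).
        pose proof (proj1 (Hn i Li) (proj1 Hi I)) as Ui.
        split.
        * intros ((_ & Ay) & (_ & Az) & J & K). split; [exact J|]. split; [exact K|].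
          intros _. split; intros F; [apply Ay|apply Az];
            (split; [exact F|]); intros u Lu Iu; split; auto; now apply (K u).
        * intros (J & K & K'). destruct (K' I) as [Ky Kz].
          split; [|split; [|now split]];
            (split; [intros u Lu Iu; now apply (K u)|intros [F _]; auto]).
      + rewrite pos_illegal by (assumption || now rewrite <- Hi).
        rewrite (IH y Ly z Lz). tauto. }
  exists Y. intros v L. rewrite HY, node_iff, (Inv v (proj1 L) v L v L). split.
  - intros (_ & _ & A) u Lu Iu. now apply (A u).
  - intros A. split; [exact L|]. split; [now apply HG|]. intros u Lu Iu. split; now apply A.
Qed.

(** * Counting the rows of a string *)

(** The vertex of a lattice path that has taken a steps for non-elements and b
    steps for elements of the k-th set.  Coding the point a + b by this pair
    makes the number order refine the order of levels, since pairs are ordered by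
    their sum. *)
Definition lnode (k a b : N) : N := pairM k (pairM a b).

Lemma lnode_inj k a b k' a' b' : lnode k a b = lnode k' a' b' -> k = k' /\ a = a' /\ b = b'.
Proof. intros E. apply pairM_inj in E as [-> E]. split; [reflexivity|]. now apply pairM_inj. Qed.

(** By the coding of T, the k-th set has b elements below i. *)
Definition count_at (T : S) (k i b : N) : Prop := exists a, a + b = i /\ lnode k a b ∈ T.

(** The k-th set is the set of the x with <k, x> in V. *)
Definition right_succ (V : S) (k i b b' : N) : Prop :=
  pairM k i ∈ V /\ b' = b + 1 \/ ~ pairM k i ∈ V /\ b' = b.

(** The bounds, implied by the equations, make the relation Sigma^B_0. *)
Definition lattice_edge (V : S) (s t : N) : Prop :=
  exists k, k <= s /\ exists a, a <= s /\ exists b, b <= s /\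
  exists a', a' <= t /\ exists b', b' <= t /\
  s = lnode k a b /\ t = lnode k a' b' /\ a' + b' = a + b + 1 /\
  ~ right_succ V k (a + b) b b'.

Lemma lnode_ge_1 k a b : k <= lnode k a b.
Proof. apply pairM_ge_l. Qed.
Lemma lnode_ge_2 k a b : a <= lnode k a b.
Proof. eapply le_trans; [apply (pairM_ge_l a b)|apply pairM_ge_r]. Qed.
Lemma lnode_ge_3 k a b : b <= lnode k a b.
Proof. eapply le_trans; [apply (pairM_ge_r a b)|apply pairM_ge_r]. Qed.

Lemma lattice_edge_lnode V k a b k' a' b' :
  lattice_edge V (lnode k a b) (lnode k' a' b') <->
  k = k' /\ a' + b' = a + b + 1 /\ ~ right_succ V k (a + b) b b'.
Proof.
  split.
  - intros (k0 & _ & a0 & _ & b0 & _ & a0' & _ & b0' & _ & E & E' & H).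
    apply lnode_inj in E as (-> & -> & ->), E' as (-> & -> & ->). now split.
  - intros (<- & H). exists k. split; [apply lnode_ge_1|]. exists a.
    split; [apply lnode_ge_2|]. exists b. split; [apply lnode_ge_3|]. exists a'.
    split; [apply lnode_ge_2|]. exists b'. split; [apply lnode_ge_3|]. now repeat split.
Qed.

(** Edges join each vertex to all vertices of the next level but its right
    successor; the kernel condition then says that every accepted vertex of the
    previous level moves on to the given one. *)
Lemma lattice_kernel V m n : exists T, forall k a b, k <= m -> a + b <= n ->
  (lnode k a b ∈ T <->
   forall a' b', a + b = a' + b' + 1 -> lnode k a' b' ∈ T ->
     right_succ V k (a' + b') b' b).
Proof.
  set (A := pairM m (pairM n n) + 1).
  assert (HA : forall k a b, k <= m -> a + b <= n -> lnode k a b < A).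
  { intros k a b L L'. apply le_lt_succ. apply pairM_mono; [exact L|].
    apply pairM_mono; eapply le_trans; [|exact L'| |exact L'].
    - apply le_add_r.
    - rewrite add_comm. apply le_add_r. }
  destruct (separation (fun z => exists s, s <= z /\ exists t, t <= z /\ z = pairM s t /\
     (s = t \/ lattice_edge V s t)) (pairM A A)) as [G HG].
  { solve_definable (ExLe $0 (ExLe $1 ($2 == npair $1 $0 ∧ ($1 == $0 ∨
       ExLe $1 (ExLe $2 (ExLe $3 (ExLe $3 (ExLe $4
         ($6 == npair $4 (npair $3 $2) ∧ $5 == npair $4 (npair $1 $0)
          ∧ $1 + $0 == ($3 + $2) + 1
          ∧ ¬ (npair $4 ($3 + $2) ∈ SVar 0 ∧ $0 == $2 + 1
               ∨ ¬ npair $4 ($3 + $2) ∈ SVar 0 ∧ $0 == $2))))))))))%fm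
      (@nil N) (V :: nil). }
  assert (HG' : forall s t, s < A -> t < A ->
            (pairM s t ∈ G <-> s = t \/ lattice_edge V s t)).
  { intros s t Ls Lt. rewrite HG. split.
    - intros [_ (s' & _ & t' & _ & E & H)]. now apply pairM_inj in E as [-> ->].
    - intros H. split.
      + now apply pairM_lt_diag.
      + exists s. split; [apply pairM_ge_l|]. exists t. split; [apply pairM_ge_r|]. now split. }
  destruct (kernel_exists G A) as [T HT].
  { intros v L. apply HG'; auto. }
  exists T. intros k a b L L'. rewrite (HT _ (HA k a b L L')). split.
  - intros H a' b' E I. apply NNPP. intros N0.
    assert (Lt : lnode k a' b' < lnode k a b).
    { apply pairM_lt_r, pairM_lt_sum. rewrite E. apply lt_succ_le. }
    apply (H _ Lt I). apply HG'; [|now apply HA|].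
    + eapply lt_le_trans; [exact Lt|apply HA; assumption].
    + right. apply lattice_edge_lnode. now split.
  - intros H u Lu I J. apply HG' in J; [|eapply lt_le_trans; [exact Lu|apply HA; assumption]
      |now apply HA].
    destruct J as [->|J]; [now apply Lu|].
    destruct J as (k0 & _ & a0 & _ & b0 & _ & a0' & _ & b0' & _ & -> & E & E' & R).
    apply lnode_inj in E as (<- & <- & <-). apply R, H; assumption.
Qed.

Definition counts_rows (V : S) (m n : N) (T : S) : Prop :=
  forall k, k <= m ->
  (forall i, i <= n -> exists b, count_at T k i b) /\
  (forall i b b', i <= n -> count_at T k i b -> count_at T k i b' -> b = b') /\
  (forall i b, i < n -> count_at T k i b ->
     exists b', count_at T k (i + 1) b' /\ right_succ V k i b b').

(** One-hot induction along the levels: if c is the only accepted vertex of a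
    level, then no edge leads from an accepted vertex to its right successor, and
    an edge leads from c to every other vertex of the next level. *)
Lemma counts_rows_exists V m n : exists T, counts_rows V m n T.
Proof.
  destruct (lattice_kernel V m n) as [T HT]. exists T. intros k Hk.
  assert (Step : forall i b b', i < n -> count_at T k i b -> count_at T k (i + 1) b' ->
            right_succ V k i b b').
  { intros i b b' Li (a & E & I) (a' & E' & I'). rewrite <- E.
    apply HT with (a' := a) (b' := b) in I'; try assumption.
    - rewrite E'. apply lt_ex in Li as [z <-]. apply le_ex. exists z. ring.
    - now rewrite E, E'. }
  assert (Succ : forall i b, exists b', right_succ V k i b b' /\ (b' = b + 1 \/ b' = b)).
  { intros i b. destruct (classic (pairM k i ∈ V)) as [I|I]; [exists (b + 1)|exists b];
      unfold right_succ; tauto. }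
  assert (SuccU : forall i b c c', right_succ V k i b c -> right_succ V k i b c' -> c = c').
  { intros i b c c' [[? ->]|[? ->]] [[? ->]|[? ->]]; tauto. }
  assert (One : forall i, i <= n -> exists b, b <= i /\ exists a, a <= i /\
     a + b = i /\ lnode k a b ∈ T /\ forall a', a' <= i -> forall b', b' <= i ->
       a' + b' = i -> lnode k a' b' ∈ T -> b' = b).
  { apply (induction (fun i => i <= n -> exists b, b <= i /\ exists a, a <= i /\
     a + b = i /\ lnode k a b ∈ T /\ forall a', a' <= i -> forall b', b' <= i ->
       a' + b' = i -> lnode k a' b' ∈ T -> b' = b)).
    - solve_definable ($0 <= $2 → ExLe $0 (ExLe $1 ($0 + $1 == $2 ∧
            npair $5 (npair $0 $1) ∈ SVar 0 ∧ AllLe $2 (AllLe $3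
             ($1 + $0 == $4 → npair $7 (npair $1 $0) ∈ SVar 0 → $0 == $3)))))%fm
          (n :: k :: nil) (T :: nil).
    - intros _. exists 0. split; [apply le_refl|]. exists 0. split; [apply le_refl|].
      split; [ring|]. split.
      + apply HT; [exact Hk|rewrite add_0_r; apply le_0_l|]. intros a b E.
        rewrite add_0_r in E. symmetry in E. now apply succ_ne_0 in E.
      + intros a' _ b' L _ _. now apply le_zero.
    - intros i IH L.
      assert (Li : i < n) by (eapply lt_le_trans; [apply lt_succ_le|exact L]).
      destruct (IH (proj1 Li)) as (b & Lb & a & La & E & I & U).
      destruct (Succ i b) as (b1 & R & C).
      assert (Ca : exists a1, a1 + b1 = i + 1).
      { destruct C as [->| ->]; [exists a|exists (a + 1)]; rewrite <- E; ring. }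
      destruct Ca as [a1 E1].
      exists b1. split; [rewrite <- E1, add_comm; apply le_add_r|].
      exists a1. split; [rewrite <- E1; apply le_add_r|]. split; [exact E1|]. split.
      + apply HT; [exact Hk|now rewrite E1|]. intros a' b' E' I'.
        assert (Q : a' + b' = i) by (apply succ_inj; now rewrite <- E', E1).
        rewrite Q.
        replace b' with b; [exact R|]. symmetry. apply (U a'); try assumption.
        * rewrite <- Q. apply le_add_r.
        * rewrite <- Q, add_comm. apply le_add_r.
      + intros a' _ b' _ E' I'. apply (SuccU i b); [|exact R].
        apply Step; [exact Li|now exists a|now exists a']. }
  assert (Uniq : forall i b b', i <= n -> count_at T k i b -> count_at T k i b' -> b = b').
  { assert (Q : forall i, i <= n -> exists c, forall b, count_at T k i b -> b = c).
    { intros i L. destruct (One i L) as (c & _ & a & _ & _ & _ & U). exists c.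
      intros b (a' & E & I). apply (U a'); try assumption; rewrite <- E.
      - apply le_add_r.
      - rewrite add_comm. apply le_add_r. }
    intros i b b' L I I'. destruct (Q i L) as [c Hc]. now rewrite (Hc b), (Hc b'). }
  split; [|split; [exact Uniq|]].
  - intros i L. destruct (One i L) as (b & _ & a & _ & E & I & _). now exists b, a.
  - intros i b Li Ci.
    destruct (One (i + 1)) as (b' & _ & a' & _ & E & I & _).
    + apply lt_ex in Li as [z <-]. apply le_ex. exists z. ring.
    + exists b'. split; [now exists a'|]. apply Step; try assumption. now exists a'.
Qed.

(** By induction on i, the row r has at most as many elements below i as the row
    s, and fewer once the witness u is below i. *)
Lemma strict_sub_count_lt V m n T r s u : counts_rows V m n T -> r <= m -> s <= m ->
  (forall x, x < n -> pairM r x ∈ V -> pairM s x ∈ V) ->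
  u < n -> pairM s u ∈ V -> ~ pairM r u ∈ V ->
  forall b b', count_at T r n b -> count_at T s n b' -> b + 1 <= b'.
Proof.
  intros HT Hr Hs Sub Lu Is Ir.
  destruct (HT r Hr) as (Exr & Ur & Sr), (HT s Hs) as (Exs & Us & Ss).
  assert (Main : forall i, i <= n -> forall a, a <= i -> forall b, b <= i ->
    forall a', a' <= i -> forall b', b' <= i -> a + b = i -> a' + b' = i ->
    lnode r a b ∈ T -> lnode s a' b' ∈ T -> b <= b' /\ (u < i -> b + 1 <= b')).
  { apply (induction (fun i => i <= n -> forall a, a <= i -> forall b, b <= i ->
    forall a', a' <= i -> forall b', b' <= i -> a + b = i -> a' + b' = i ->
    lnode r a b ∈ T -> lnode s a' b' ∈ T -> b <= b' /\ (u < i -> b + 1 <= b'))).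
    - solve_definable ($0 <= $2 → AllLe $0 (AllLe $1 (AllLe $2 (AllLe $3
        ($3 + $2 == $4 → $1 + $0 == $4 → npair $7 (npair $3 $2) ∈ SVar 0 →
         npair $8 (npair $1 $0) ∈ SVar 0 → $2 <= $0 ∧ ($9 < $4 → $2 + 1 <= $0))))))%fm
        (n :: r :: s :: u :: nil) (T :: nil).
    - intros _ a _ b L a' _ b' _ _ _ _ _. apply le_zero in L as ->.
      split; [apply le_0_l|]. intros L. now apply not_lt_0 in L.
    - intros i IH L a _ b _ a' _ b' _ E E' I I'.
      assert (Li : i < n) by (eapply lt_le_trans; [apply lt_succ_le|exact L]).
      assert (IH' : forall b b', count_at T r i b -> count_at T s i b' ->
                b <= b' /\ (u < i -> b + 1 <= b')).
      { intros c c' (d & D & J) (d' & D' & J').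
        apply (IH (proj1 Li) d) with (a' := d'); try assumption.
        - rewrite <- D. apply le_add_r.
        - rewrite <- D, add_comm. apply le_add_r.
        - rewrite <- D'. apply le_add_r.
        - rewrite <- D', add_comm. apply le_add_r. }
      destruct (Exr i (proj1 Li)) as [c Hc], (Exs i (proj1 Li)) as [c' Hc'].
      destruct (Sr i c Li Hc) as (d & Hd & Rd), (Ss i c' Li Hc') as (d' & Hd' & Rd').
      assert (b = d) as -> by (apply (Ur (i + 1)); [exact L|now exists a|exact Hd]).
      assert (b' = d') as -> by (apply (Us (i + 1)); [exact L|now exists a'|exact Hd']).
      destruct (IH' c c' Hc Hc') as [A B].
      assert (P : forall x y, x <= y -> x + 1 <= y + 1).
      { intros x y [z <-]%le_ex. apply le_ex. exists z. ring. }
      assert (Pu : u < i + 1 -> u <> i -> u < i).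
      { intros H Q. split; [now apply le_lt_succ|exact Q]. }
      destruct Rd as [[Jr ->]|[Jr ->]], Rd' as [[Js ->]|[Js ->]].
      + split; [now apply P|]. intros H. apply P, B, Pu; [exact H|]. now intros ->.
      + now apply Sub in Jr.
      + split; [eapply le_trans, le_add_r; exact A|]. intros _. now apply P.
      + split; [exact A|]. intros H. apply B, Pu; [exact H|]. now intros ->. }
  intros b b' (a & E & I) (a' & E' & I').
  apply (Main n (le_refl n) a) with (a' := a'); try assumption.
  - rewrite <- E. apply le_add_r.
  - rewrite <- E, add_comm. apply le_add_r.
  - rewrite <- E'. apply le_add_r.
  - rewrite <- E', add_comm. apply le_add_r.
Qed.

Definition strict_sub (V : S) (n r s : N) : Prop :=
  (forall x, x < n -> pairM r x ∈ V -> pairM s x ∈ V) /\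
  exists u, u < n /\ pairM s u ∈ V /\ ~ pairM r u ∈ V.

(** The rows <i, 0> and <i, 1> alternate, which avoids an arithmetic of parity for
    a chain of length 2 L.  By induction on i, the row <i, 0> has at most n - 2i
    elements. *)
Lemma strict_chain_length V n L :
  (forall i, i < L -> strict_sub V n (pairM i 1) (pairM i 0) /\
                      strict_sub V n (pairM (i + 1) 0) (pairM i 1)) ->
  L + L <= n.
Proof.
  intros H. destruct (counts_rows_exists V (pairM L 1) n) as [T HT].
  assert (H0 : forall i, i <= L -> pairM i 0 <= pairM L 1).
  { intros i Li. apply pairM_mono; [exact Li|apply le_0_l]. }
  assert (H1 : forall i, i <= L -> pairM i 1 <= pairM L 1).
  { intros i Li. apply pairM_mono; [exact Li|apply le_refl]. }
  assert (Main : forall i, i <= L -> forall a, a <= n -> forall b, b <= n ->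
            a + b = n -> lnode (pairM i 0) a b ∈ T -> b + (i + i) <= n).
  { apply (induction (fun i => i <= L -> forall a, a <= n -> forall b, b <= n ->
            a + b = n -> lnode (pairM i 0) a b ∈ T -> b + (i + i) <= n)).
    - solve_definable ($0 <= $2 → AllLe $3 (AllLe $4 ($1 + $0 == $5 →
        npair (npair $2 0) (npair $1 $0) ∈ SVar 0 → $0 + ($2 + $2) <= $5)))%fm
        (L :: n :: nil) (T :: nil).
    - intros _ a _ b Lb _ _. rewrite !add_0_r. exact Lb.
    - intros i IH Li1 a _ b _ E I.
      assert (Li : i < L) by (eapply lt_le_trans; [apply lt_succ_le|exact Li1]).
      destruct (H i Li) as [(S1 & u1 & Lu1 & I1 & N1) (S2 & u2 & Lu2 & I2 & N2)].
      destruct (proj1 (HT _ (H0 i (proj1 Li))) n (le_refl n)) as [c0 Hc0].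
      destruct (proj1 (HT _ (H1 i (proj1 Li))) n (le_refl n)) as [c1 Hc1].
      pose proof (strict_sub_count_lt _ _ _ _ _ _ _ HT (H1 i (proj1 Li)) (H0 i (proj1 Li))
                    S1 Lu1 I1 N1 _ _ Hc1 Hc0) as [x X]%le_ex.
      pose proof (strict_sub_count_lt _ _ _ _ _ _ _ HT (H0 _ Li1) (H1 i (proj1 Li))
                    S2 Lu2 I2 N2 b c1 (ex_intro _ a (conj E I)) Hc1) as [y Y]%le_ex.
      destruct Hc0 as (a0 & E0 & I0).
      assert (Q : c0 + (i + i) <= n).
      { apply (IH (proj1 Li) a0); try assumption; rewrite <- E0.
        - apply le_add_r.
        - rewrite add_comm. apply le_add_r. }
      eapply le_trans, Q. apply le_ex. exists (x + y). rewrite <- X, <- Y. ring. }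
  destruct (proj1 (HT _ (H0 L (le_refl L))) n (le_refl n)) as (b & a & E & I).
  eapply le_trans; [|apply (Main L (le_refl L) a) with (b := b); try assumption].
  - rewrite (add_comm b). apply le_add_r.
  - rewrite <- E. apply le_add_r.
  - rewrite <- E, add_comm. apply le_add_r.
Qed.

(** * Grundy values and the strategies *)

Definition winning_move (v : N) (G : S) : Prop :=
  v ∈ nodeM M G /\ sgM M (delM M G v) = 0.

Lemma tau_wins G v : winning_move v G -> winning_move (tauM M G) G.
Proof.
  intros W. apply (HM _ (VNK_NK _ Tau_some) (nums nil) (strs (G :: nil))).
  exists v. split; [apply mem_lt_len, W|]. split; apply W.
Qed.

(** The value of a bounded minimization may be the bound; so sg(G) differs from
    the values of the options only if it is below |V_G|. *)
Lemma sg_min G : ugraphM G -> G <> emptyM M ->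
  (sgM M G < lenM M (nodeM M G) ->
     forall x, x ∈ nodeM M G -> sgM M G <> sgM M (delM M G x)) /\
  (forall k, k < sgM M G -> exists x, x ∈ nodeM M G /\ k = sgM M (delM M G x)).
Proof.
  intros U Z.
  destruct (HM _ (VNK_NK _ Sg_graph) (nums nil) (strs (G :: nil))) as (_ & A & B).
  - now apply sat_UGraph.
  - exact Z.
  - cbn in A, B. split.
    + intros L x I. exact (A L x (mem_lt_len _ _ I) I).
    + intros k L. apply NNPP. intros No. apply (B k L). intros x _ I E.
      apply No. now exists x.
Qed.

Lemma sg_nonzero G : ugraphM G -> sgM M G <> 0 -> winning_move (tauM M G) G.
Proof.
  intros U Q.
  assert (Z : G <> emptyM M).
  { intros Z. apply Q. exact (HM _ (VNK_NK _ Sg_empty) (nums nil) (strs (G :: nil)) Z). }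
  destruct (proj2 (sg_min G U Z) 0) as (x & I & E).
  - split; [apply le_0_l|congruence].
  - apply (tau_wins G x). now split.
Qed.

Lemma sg_zero G x : ugraphM G -> sgM M G = 0 -> x ∈ nodeM M G ->
  sgM M (delM M G x) <> 0.
Proof.
  intros U Q I E.
  assert (Z : G <> emptyM M).
  { intros ->. apply node_iff in I. now apply not_mem_empty in I. }
  apply (proj1 (sg_min G U Z)) with x; [|exact I|congruence].
  rewrite Q. eapply le_lt_trans; [apply le_0_l|apply mem_lt_len, I].
Qed.

(** Both strategies at once; [true] stands for tau_A. *)
Definition strat (c : bool) (X G : sterm) : sterm :=
  if c then TauA X G else TauB X G.
Definition stratM (c : bool) (X G : S) : S :=
  if c then tauAM M X G else tauBM M X G.

Definition reply (G A : S) (b : N) : N := tauM M (posM M G (snocM M A b)).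

Lemma strat_snoc c B b G : seqM B -> stratM c (snocM M B b) G =
  snocM M (snocM M (stratM c B G) b) (reply G (stratM c B G) b).
Proof.
  intros HB. destruct c.
  - apply (HM _ (VNK_NK _ TauA_snoc) (nums (b :: nil)) (strs (G :: B :: nil))).
    now apply sat_Seq.
  - apply (HM _ (VNK_NK _ TauB_snoc) (nums (b :: nil)) (strs (G :: B :: nil))).
    now apply sat_Seq.
Qed.

(** The invariant of a play: after the moves A, the player to move loses.  Every
    position is a subgraph of the initial one, whence the common bound n. *)
Definition losing (n : N) (G A : S) : Prop :=
  seqM A /\ ugraphM (posM M G A) /\ sgM M (posM M G A) = 0 /\
  forall x, x ∈ nodeM M (posM M G A) -> x < n.

(** Alice has already moved when the invariant starts to hold, Bob has not. *)
Lemma losing_start (c : bool) n G : ugraphM G -> n = lenM M (nodeM M G) ->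
  (if c then sgM M G <> 0 else sgM M G = 0) ->
  losing n G (stratM c (emptyM M) G).
Proof.
  intros U -> H. destruct c.
  - cbn. rewrite (HM _ (VNK_NK _ TauA_empty) (nums nil) (strs (G :: nil)) : tauAM M _ G = _).
    cbn. destruct (sg_nonzero G U H) as [I E].
    split; [apply seq_snoc, seq_empty|].
    rewrite pos_legal, pos_empty by (apply seq_empty || now rewrite pos_empty).
    split; [now apply ugraph_del|]. split; [exact E|].
    intros x J. apply node_del in J as [J _]. now apply mem_lt_len.
  - cbn. rewrite (HM _ (VNK_NK _ TauB_empty) (nums nil) (strs (G :: nil)) : tauBM M _ G = _).
    cbn. split; [apply seq_empty|]. rewrite pos_empty. split; [exact U|].
    split; [exact H|]. intros x. apply mem_lt_len.
Qed.

(** A legal move of the losing side leads to sg different from 0, where tau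
    answers with a move back to sg = 0.  The positions after the move and after
    the answer are identified as G_x, so that the deleted nodes can be counted. *)
Lemma losing_step n G A b : losing n G A -> b ∈ nodeM M (posM M G A) ->
  seqM (snocM M A b) /\
  posM M G (snocM M A b) = delM M (posM M G A) b /\
  reply G A b ∈ nodeM M (posM M G (snocM M A b)) /\
  posM M G (snocM M (snocM M A b) (reply G A b))
    = delM M (posM M G (snocM M A b)) (reply G A b) /\
  losing n G (snocM M (snocM M A b) (reply G A b)).
Proof.
  intros (HA & U & E & Ln) I.
  assert (HA' := seq_snoc _ b HA).
  assert (P := pos_legal _ _ _ HA I).
  assert (U' : ugraphM (posM M G (snocM M A b))) by (rewrite P; now apply ugraph_del).
  assert (W : winning_move (reply G A b) (posM M G (snocM M A b))).
  { apply sg_nonzero; [exact U'|]. rewrite P. now apply sg_zero. }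
  assert (P' := pos_legal _ _ _ HA' (proj1 W)).
  split; [exact HA'|]. split; [exact P|]. split; [apply W|]. split; [exact P'|].
  split; [now apply seq_snoc|]. rewrite P'.
  split; [now apply ugraph_del|]. split; [apply W|].
  intros x J. apply node_del in J as [J _]. rewrite P in J.
  apply node_del in J as [J _]. now apply Ln.
Qed.

(** * Plays against the strategies *)

Section Play.
Variables (c : bool) (G C : S) (l n : N).
Hypothesis HG : ugraphM G.
Hypothesis Hn : n = lenM M (nodeM M G).
Hypothesis Hsg : if c then sgM M G <> 0 else sgM M G = 0.
Hypothesis HC : seqM C.
Hypothesis HlC : lhM M C = l + 1.

Let at_ (i : N) : S := stratM c (preM M C i) G.
Let mv (i : N) : N := eltM M C i.

Lemma at_succ i : i <= l ->
  at_ (i + 1) = snocM M (snocM M (at_ i) (mv i)) (reply G (at_ i) (mv i)).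
Proof.
  intros L. apply le_lt_succ in L. rewrite <- HlC in L. unfold at_.
  rewrite pre_succ by assumption. apply strat_snoc, seq_pre; [exact HC|apply L].
Qed.

Lemma losing_invariant L : L <= l + 1 ->
  (forall i, i < L -> mv i ∈ nodeM M (posM M G (at_ i))) ->
  forall i, i <= L -> losing n G (at_ i).
Proof.
  intros HL Legal.
  apply (induction (fun i => i <= L -> losing n G (at_ i))).
  - exists ($0 <= $2 → Seq (strat c (Pre (SVar 0) $0) (SVar 1))
      ∧ UGraph (Pos (SVar 1) (strat c (Pre (SVar 0) $0) (SVar 1)))
      ∧ Sg (Pos (SVar 1) (strat c (Pre (SVar 0) $0) (SVar 1))) == 0
      ∧ AllIn (Node (Pos (SVar 1) (strat c (Pre (SVar 0) $0) (SVar 1)))) ($0 < $4))%fm,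
      (nums (L :: n :: nil)), (strs (C :: G :: nil)).
    split; [repeat constructor|]. intros a y.
    cbn [sat]. rewrite sat_Seq, sat_UGraph. unfold losing, at_.
    destruct c; cbn; split; intros H Ly;
      (destruct (H Ly) as (H1 & H2 & H3 & H4); split; [exact H1|];
       split; [exact H2|]; split; [exact H3|]); intros x; auto;
      intros I; exact (H4 x (mem_lt_len _ _ I) I).
  - intros _. unfold at_. rewrite pre_0 by exact HC. now apply losing_start.
  - intros i IH Li.
    assert (Li' : i < L) by (eapply lt_le_trans; [apply lt_succ_le|exact Li]).
    rewrite at_succ.
    + apply losing_step; [apply IH, Li'|now apply Legal].
    + apply le_lt_succ. eapply lt_le_trans; [exact Li'|exact HL].
Qed.

(** The row <i, 0> holds the nodes before the i-th move of the opponent, the row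
    <i, 1> those after it.  Each step is proper, as a move deletes the node
    itself because of its loop. *)
Lemma too_many_moves : (forall i, i <= l -> mv i ∈ nodeM M (posM M G (at_ i))) ->
  (l + 1) + (l + 1) <= n.
Proof.
  intros Legal.
  assert (Inv : forall i, i <= l + 1 -> losing n G (at_ i)).
  { apply losing_invariant; [apply le_refl|]. intros i L. apply Legal, le_lt_succ, L. }
  set (B := pairM (pairM (l + 1) 1) n + 1).
  destruct (separation (fun z => exists i, i <= z /\ exists x, x <= z /\
      (z = pairM (pairM i 0) x /\ x ∈ nodeM M (posM M G (at_ i)) \/
       z = pairM (pairM i 1) x /\ x ∈ nodeM M (posM M G (snocM M (at_ i) (mv i))))) B)
    as [V HV].
  { unfold at_. destruct c;
    [solve_definable (ExLe $0 (ExLe $1 (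
       $2 == npair (npair $1 0) $0 ∧ $0 ∈ Node (Pos (SVar 1) (TauA (Pre (SVar 0) $1) (SVar 1)))
     ∨ $2 == npair (npair $1 1) $0 ∧ $0 ∈ Node (Pos (SVar 1)
         (Snoc (TauA (Pre (SVar 0) $1) (SVar 1)) (Elt (SVar 0) $1))))))%fm
      (@nil N) (C :: G :: nil)
    |solve_definable (ExLe $0 (ExLe $1 (
       $2 == npair (npair $1 0) $0 ∧ $0 ∈ Node (Pos (SVar 1) (TauB (Pre (SVar 0) $1) (SVar 1)))
     ∨ $2 == npair (npair $1 1) $0 ∧ $0 ∈ Node (Pos (SVar 1)
         (Snoc (TauB (Pre (SVar 0) $1) (SVar 1)) (Elt (SVar 0) $1))))))%fm
      (@nil N) (C :: G :: nil)]. }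
  assert (Zne : 0 <> 1).
  { intros E. apply (succ_ne_0 0). now rewrite add_0_l, <- E. }
  assert (V0 : forall i x, i <= l + 1 -> x < n ->
            (pairM (pairM i 0) x ∈ V <-> x ∈ nodeM M (posM M G (at_ i)))).
  { intros i x Li Lx. rewrite HV. split.
    - intros (_ & j & _ & y & _ & [[E I]|[E I]]); apply pairM_inj in E as [E ->];
        apply pairM_inj in E as [-> E]; [exact I|congruence].
    - intros I. split.
      + apply le_lt_succ, pairM_mono; [apply pairM_mono; [exact Li|apply le_0_l]|apply Lx].
      + exists i. split; [eapply le_trans; [apply (pairM_ge_l i 0)|apply pairM_ge_l]|].
        exists x. split; [apply pairM_ge_r|]. now left. }
  assert (V1 : forall i x, i <= l + 1 -> x < n ->
            (pairM (pairM i 1) x ∈ V <-> x ∈ nodeM M (posM M G (snocM M (at_ i) (mv i))))).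
  { intros i x Li Lx. rewrite HV. split.
    - intros (_ & j & _ & y & _ & [[E I]|[E I]]); apply pairM_inj in E as [E ->];
        apply pairM_inj in E as [-> E]; [congruence|exact I].
    - intros I. split.
      + apply le_lt_succ, pairM_mono; [apply pairM_mono; [exact Li|apply le_refl]|apply Lx].
      + exists i. split; [eapply le_trans; [apply (pairM_ge_l i 1)|apply pairM_ge_l]|].
        exists x. split; [apply pairM_ge_r|]. now right. }
  apply (strict_chain_length V). intros i Li. apply le_lt_succ in Li.
  assert (Li1 : i <= l + 1) by (eapply le_trans; [exact Li|apply le_add_r]).
  assert (Li2 : i + 1 <= l + 1).
  { apply le_ex in Li as [z <-]. apply le_ex. exists z. ring. }
  pose proof (Inv i Li1) as Hi. pose proof (Legal i Li) as I.
  destruct (losing_step _ _ _ _ Hi I) as (_ & P & J & P' & _).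
  rewrite <- (at_succ i Li) in P'.
  assert (Ln : forall x, x ∈ nodeM M (posM M G (at_ i)) -> x < n) by apply Hi.
  assert (Loop : forall H x, x ∈ nodeM M H -> ~ x ∈ nodeM M (delM M H x)).
  { intros H x Ix Id. apply node_del in Id as [_ Id]. now apply Id, node_iff. }
  assert (LJ : reply G (at_ i) (mv i) < n).
  { apply Ln. rewrite P in J. now apply node_del in J. }
  split; split.
  - intros x Lx. rewrite V0, V1, P by assumption. apply node_del.
  - exists (mv i). split; [now apply Ln|]. rewrite V0, V1, P by auto.
    split; [exact I|now apply Loop].
  - intros x Lx. rewrite V0, V1, P' by assumption. apply node_del.
  - exists (reply G (at_ i) (mv i)). split; [exact LJ|].
    rewrite V0, V1, P' by assumption. split; [exact J|now apply Loop].
Qed.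

(** The opponent's first illegal move, which exists by [too_many_moves]. *)
Lemma first_illegal_move : n < (l + 1) + (l + 1) -> exists l0, l0 <= l /\
  (forall i, i < l0 -> mv i ∈ nodeM M (posM M G (at_ i)) /\
     reply G (at_ i) (mv i) ∈ nodeM M (posM M G (snocM M (at_ i) (mv i)))) /\
  ~ mv l0 ∈ nodeM M (posM M G (at_ l0)).
Proof.
  intros Hl.
  destruct (classic (exists i, i <= l /\ ~ mv i ∈ nodeM M (posM M G (at_ i))))
    as [(i & Li & I)|No].
  - destruct (least (fun i => ~ mv i ∈ nodeM M (posM M G (at_ i)))) with i
      as (l0 & Hl0 & L0 & Min); [|exact I|].
    + unfold mv, at_. destruct c;
        [solve_definable (¬ Elt (SVar 0) $0 ∈ Node (Pos (SVar 1) (TauA (Pre (SVar 0) $0) (SVar 1))))%fm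
           (@nil N) (C :: G :: nil)
        |solve_definable (¬ Elt (SVar 0) $0 ∈ Node (Pos (SVar 1) (TauB (Pre (SVar 0) $0) (SVar 1))))%fm
           (@nil N) (C :: G :: nil)].
    + assert (Ll : l0 <= l) by (eapply le_trans; eassumption).
      exists l0. split; [exact Ll|]. split; [|exact Hl0].
      assert (Legal : forall i, i < l0 -> mv i ∈ nodeM M (posM M G (at_ i))).
      { intros j Lj. apply NNPP, Min, Lj. }
      intros j Lj. split; [now apply Legal|].
      apply (losing_step n); [|now apply Legal].
      apply (losing_invariant l0); [|exact Legal|apply Lj].
      eapply le_trans; [exact Ll|apply le_add_r].
  - exfalso. eapply le_not_lt, Hl. apply too_many_moves. intros i L.
    apply NNPP. intros I. apply No. now exists i.
Qed.

End Play.

Lemma floor_half_bound l n : l + l = n \/ (l + l) + 1 = n -> n < (l + 1) + (l + 1).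
Proof.
  intros [<-|<-]; apply lt_ex; [exists 1|exists 0]; ring.
Qed.

Lemma ceil_half_bound l n : l + l = n \/ l + l = n + 1 -> n < (l + 1) + (l + 1).
Proof.
  intros [<-|E]; apply lt_ex; [exists 1; ring|exists (1 + 1)].
  transitivity ((l + l) + 1 + 1); [rewrite E|]; ring.
Qed.

End Model.

Theorem theorem1 :
  proves VNK
    (AllStr
       (let G := SVar 0 in
        Imp (UGraph G)
            (And (Imp (Not (EqN (Sg G) NZero)) (AWS G))
                 (Imp (EqN (Sg G) NZero) (BWS G))))).
Proof.
  apply completeness. intros M HM r s G HG.
  apply sat_UGraph in HG; [|exact HM].
  split; intros Hsg l C [HC HlC] [Hl _]; apply sat_Seq in HC; try exact HM.
  - exact (first_illegal_move M HM true G C l _ HG eq_refl Hsg HC HlC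
             (floor_half_bound M HM _ _ Hl)).
  - exact (first_illegal_move M HM false G C l _ HG eq_refl Hsg HC HlC
             (ceil_half_bound M HM _ _ Hl)).
Qed.
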